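(* Let $\Omega=\{(\tau(C),\phi(C),\beta(C)):C\in\mathcal{C}\}\subseteq\mathbb{R}^3$, where $\mathcal{C}$ is the class of all bivariate copulas and $\tau,\phi,\beta$ are Kendall's tau, Spearman's footrule and Blomqvist's beta. Then $\Omega$ is compact and convex. Moreover, for $p\in[-\tfrac12,1]$ define $$b_-(p)=1-\sqrt{\tfrac83(1-p)},\qquad b_+(p)=\min\Bigl\{1,\,-1+\tfrac{4}{\sqrt3}\sqrt{p+\tfrac12}\Bigr\}.$$ Then, for every $p\in[-\tfrac12,1]$, the section of $\Omega$ at fixed footrule $p$ is the possibly degenerate rectangle $$\bigl\{(t,b)\in\mathbb{R}^2:(t,p,b)\in\Omega\bigr\}=\bigl[\tfrac43p-\tfrac13,\ \tfrac23p+\tfrac13\bigr]\times[b_-(p),b_+(p)].$$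
   Context: A (bivariate) copula is a distribution function $C$ on $[0,1]^2$ with uniform marginals; it induces a probability measure on $[0,1]^2$, and integrals $\int \cdot\,\mathrm{d}C$ are Lebesgue--Stieltjes integrals with respect to this measure. For a copula $C$: Kendall's tau is $\tau(C)=4\int_{[0,1]^2}C(u,v)\,\mathrm{d}C(u,v)-1$; Spearman's footrule is $\phi(C)=6\int_0^1 C(u,u)\,\mathrm{d}u-2$; Blomqvist's beta is $\beta(C)=4C(\tfrac12,\tfrac12)-1$. *)

(* Defs.v *)
From HB Require Import structures.
From mathcomp Require Import all_boot all_order all_algebra.
From mathcomp Require Import all_classical all_reals all_analysis.

Set Implicit Arguments.
Unset Strict Implicit.
Unset Printing Implicit Defensive.

Import Order.TTheory GRing.Theory Num.Theory.
Import numFieldNormedType.Exports.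

Local Open Scope classical_set_scope.
Local Open Scope ring_scope.

(* [C] is the distribution function on the unit square of the measure [mu].
   Only the values of [C] on the unit square are constrained. *)
Definition distribution_function_of (R : realType)
    (mu : probability (R * R)%type R) (C : R -> R -> R) : Prop :=
  forall u v : R, 0 <= u <= 1 -> 0 <= v <= 1 ->
    mu (`[0, u] `*` `[0, v]) = (C u v)%:E.

(* The margin conditions give C 1 1 = 1, so every measure as in
   [copula_distribution] is concentrated on the unit square; they also give
   C 0 v = C u 0 = 0. *)
Record copula (R : realType) := Copula {
  copula_fun :> R -> R -> R;
  copula_distribution :
    exists mu : probability (R * R)%type R,
      distribution_function_of mu copula_fun;
  copula_margin1 : forall u : R, 0 <= u <= 1 -> copula_fun u 1 = u;
  copula_margin2 : forall v : R, 0 <= v <= 1 -> copula_fun 1 v = v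
}.

(* The probability measure induced by [C]; the choice is immaterial, since the
   distribution function determines the measure. *)
Definition copula_measure (R : realType) (C : copula R) :
    probability (R * R)%type R :=
  projT1 (cid (copula_distribution C)).

Lemma copula_measureP (R : realType) (C : copula R) :
  distribution_function_of (copula_measure C) C.
Proof. exact: projT2 (cid (copula_distribution C)). Qed.

Definition kendall_tau (R : realType) (C : copula R) : R :=
  4 * (\int[copula_measure C]_(z in `[0%R, 1%R] `*` `[0%R, 1%R]) C z.1 z.2) - 1.

Definition spearman_footrule (R : realType) (C : copula R) : R :=
  6 * (\int[lebesgue_measure]_(u in `[0%R, 1%R]) C u u) - 2.

Definition blomqvist_beta (R : realType) (C : copula R) : R :=
  4 * C (1 / 2) (1 / 2) - 1.

(* The factors are written [R^o] to endow R^3 with its vector space structure, in addition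
   to the product topology. *)
Definition Omega (R : realType) : set (R^o * R^o * R^o) :=
  [set (kendall_tau C, spearman_footrule C, blomqvist_beta C) |
     C in [set: copula R]].
Arguments Omega : clear implicits.

Definition b_minus (R : realType) (p : R) : R :=
  1 - Num.sqrt (8 / 3 * (1 - p)).

Definition b_plus (R : realType) (p : R) : R :=
  Num.min 1 (- 1 + 4 / Num.sqrt 3 * Num.sqrt (p + 1 / 2)).

(* Main.v *)
(* Write d(u) = C(u, u) and D = \int d.  For (U, V) distributed as C one has
   E min(U, V) = D, and all bounds follow from pointwise inequalities.
   - d(v) + min(u, v) - v <= C(u, v) <= min(u, v); integrating with respect to C
     gives 2 D - 1/2 <= \int C dC <= D, the continuous Diaconis-Graham
     inequality, that is the bounds on tau in terms of the footrule.
   - d is nondecreasing, 2-Lipschitz and between max(0, 2u - 1) and u, so its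
     value at 1/2 confines D to an interval; this relates beta and the footrule.
   For sharpness, a Lebesgue-preserving map f of [0, 1] yields the copula carried
   by its graph.  When C = min on the graph the upper bound for tau is attained,
   and a two-parameter family of involutions exchanging intervals by translation
   realizes every admissible (footrule, beta).  Exchanging the intervals by
   reflections instead attains the lower bound.  Finally, tau is a quadratic
   function along the segment joining the two extremal copulas, whereas the
   footrule and beta are constant there, so every intermediate tau occurs. *)

Require Import Defs.
From mathcomp Require Import all_boot all_order all_algebra.
From mathcomp Require Import all_classical all_reals all_analysis.
From HB Require Import structures.
From mathcomp Require Import measurable_realfun ring lra.
Import Order.TTheory GRing.Theory Num.Theory.
Import numFieldNormedType.Exports.
Local Open Scope classical_set_scope.
Local Open Scope ring_scope.

Set Implicit Arguments.
Unset Strict Implicit.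
Unset Printing Implicit Defensive.

(** * Uniqueness of the measure induced by a copula *)

(** Tau is defined through a chosen measure, while every construction supplies a measure of its own;
    hence uniqueness comes first. The identity E min(U, V) = D arises from P(max(U, V) <= x) = C(x,
    x), which gives E(1 - max) = D, together with min + max = U + V. The pivot is an exact
    description of [Omega] by polynomial inequalities: affine bounds on tau and convex quadratic
    bounds on beta, both in terms of the footrule. Compactness, convexity and the sections are read
    off from it. Mixing copulas alone would not give convexity, because tau is not affine under
    mixing. Sections are rectangles because the diagonal determines footrule and beta but leaves tau
    free. For the copula of a map f, u - C(u, u) is the length at time u of a queue: a point x < f x
    enters at time x and leaves at time f x. Changing the service order does not change the length.
    Last in first out is the equality case of the lower bound on tau, first in first out that of the
    upper bound. *)

Section Uniqueness.
Context {R : realType}.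
Implicit Types (A B : set R).
Local Notation I := (`[0%R, 1%R]%classic : set R).

Lemma unit_itvP (x : R) : I x -> 0 <= x <= 1.
Proof. by rewrite /= in_itv. Qed.

Lemma setI_ray_unit (x : R) : 0 <= x <= 1 ->
  `]x, +oo[%classic `&` I = I `\` `[0, x]%classic.
Proof.
move=> x01; apply/seteqP; split=> y /=; rewrite !in_itv/=.
  by move=> [? /andP[-> ->]]; split => //; apply/negP; rewrite -ltNge; lra.
by move=> [/andP[y0 ->]]; rewrite y0/= => /negP; rewrite -ltNge andbT.
Qed.

Lemma setI_unit_itv (x : R) : 0 <= x <= 1 -> I `&` `[0, x]%classic = `[0, x]%classic.
Proof.
by move=> x01; rewrite setIidr// => y /=; rewrite !in_itv/= => /andP[-> ?]/=; lra.
Qed.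

(** Rays form the generating pi-system: inside the unit interval a ray is the complement of some
    [[0, x]], so finiteness carries the equality from these intervals over to rays. *)
Lemma finite_measure_eq_unit (m1 m2 : {measure set (measurableTypeR R) -> \bar R}) :
  m1 I \is a fin_num -> m1 (~` I) = 0%E -> m2 (~` I) = 0%E ->
  (forall u, 0 <= u <= 1 -> m1 `[0, u]%classic = m2 `[0, u]%classic) ->
  forall A, measurable A -> m1 A = m2 A.
Proof.
move=> m1I m1C m2C m12 A mA.
have mI : measurable (I : set (measurableTypeR R)) by exact: measurable_itv.
have mC : measurable (~` I : set (measurableTypeR R)) by exact: measurableC.
have restrI (m : {measure set (measurableTypeR R) -> \bar R}) (B : set (measurableTypeR R)) :
    m (~` I) = 0%E -> measurable B -> m B = m (B `&` I).
  move=> m0 mB; rewrite -[RHS]add0e; apply: (etrans (measureDI m mB mI)).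
  congr adde.
  apply/eqP; rewrite eq_le measure_ge0 andbT -m0.
  by apply: le_measure; rewrite ?inE//; exact: measurableD.
have m2I : m2 I = m1 I by rewrite m12// ler01 lexx.
have m2fin : m2 I \is a fin_num by rewrite m2I.
apply: (@measure_unique _ R (measurableTypeR R) (@RGenOInfty.G R)
  (fun n => `]- n%:R, +oo[%classic)) => //.
- exact: RGenOInfty.measurableE.
- move=> _ _ [x ->] [y ->]; exists (Num.max x y).
  apply/seteqP; split=> z /=; rewrite !in_itv/= !andbT gt_max; first by move=> [-> ->].
  by move=> /andP[-> ->].
- by move=> n; exists (- n%:R).
- apply/seteqP; split=> // x _; exists (Num.truncn `|x|).+1 => //=.
  by rewrite in_itv/= andbT ltrNl (le_lt_trans _ (truncnS_gt `|x|))// -normrN ler_norm.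
- move=> _ [x ->].
  have mx : measurable (`]x, +oo[%classic : set (measurableTypeR R)) by exact: measurable_itv.
  rewrite (restrI m1)// (restrI m2)//.
  have [x0|x0] := ltP x 0.
    suff -> : `]x, +oo[%classic `&` I = I by rewrite m2I.
    apply/seteqP; split=> [y []//|y /=].
    by rewrite !in_itv/= => /andP[y0 y1]; rewrite y0 y1 (lt_le_trans x0).
  have [x1|x1] := leP x 1; last first.
    suff -> : `]x, +oo[%classic `&` I = set0 by rewrite !measure0.
    apply/seteqP; split=> [y []|y //] /=.
    by rewrite !in_itv/= andbT => xy /andP[_ /(lt_le_trans xy)/(lt_trans x1)]; rewrite ltxx.
  have x01 : 0 <= x <= 1 by rewrite x0.
  rewrite setI_ray_unit//.
  have mx' : measurable (`[0, x]%classic : set (measurableTypeR R)) by exact: measurable_itv.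
  have m12x := m12 x x01; rewrite -(setI_unit_itv x01) in m12x.
  apply: (etrans (measureD mI mx' _)); first by rewrite -ge0_fin_numE.
  apply/esym; apply: (etrans (measureD mI mx' _)); first by rewrite -ge0_fin_numE//; exact: m2fin.
  exact: (congr2 (fun a b => a - b)%E m2I (esym m12x)).
- move=> k; have mk : measurable (`]- k%:R, +oo[%classic : set (measurableTypeR R)).
    exact: measurable_itv.
  rewrite (restrI m1)//.
  apply: (@le_lt_trans _ _ (m1 I)); last by rewrite -ge0_fin_numE.
  by apply: le_measure; rewrite ?inE//; exact: measurableI.
Qed.
End Uniqueness.

Section InducedMeasure.
Context {R : realType}.
Local Notation I := (`[0%R, 1%R]%classic : set R).
Local Notation Q := (I `*` I).
Variable C : copula R.
Implicit Type mu : probability (R * R)%type R.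

Lemma measurable_unit_square : measurable Q.
Proof. by apply: measurableX; exact: measurable_itv. Qed.

Lemma copula_measure_square mu : distribution_function_of mu C -> mu Q = 1%E.
Proof. by move=> muC; rewrite muC ?lexx ?ler01// copula_margin1 ?lexx ?ler01. Qed.

Lemma copula_measure_out mu : distribution_function_of mu C -> mu (~` Q) = 0%E.
Proof.
move=> muC; rewrite probability_setC; last exact: measurable_unit_square.
by rewrite copula_measure_square// subee.
Qed.

Lemma copula_measure_null mu (X : set (R * R)) : distribution_function_of mu C ->
  measurable X -> X `<=` ~` Q -> mu X = 0%E.
Proof.
move=> muC mX XQ; apply/eqP; rewrite eq_le measure_ge0 andbT -(copula_measure_out muC).
apply: le_measure; rewrite ?inE//.
by apply: measurableC; exact: measurable_unit_square.
Qed.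

Lemma copula_measure_restr mu (X Y : set (R * R)) : distribution_function_of mu C ->
  measurable X -> measurable Y -> X `&` Q = Y `&` Q -> mu X = mu Y.
Proof.
move=> muC mX mY XY; have mQ := measurable_unit_square.
suff H (Z : set (R * R)) : measurable Z -> mu Z = mu (Z `&` Q) by rewrite H// XY -H.
move=> mZ; rewrite -[RHS]add0e; apply: (etrans (measureDI mu mZ mQ)); congr adde.
by apply: copula_measure_null => //; exact: measurableD.
Qed.

(** The codomain is retyped as [measurableTypeR R], so that push-forwards along the projections are
    measures to which [finite_measure_eq_unit] applies. *)
Lemma measurable_fst_R : measurable_fun setT (fst : R * R -> measurableTypeR R).
Proof. exact: measurable_fst. Qed.
Lemma measurable_snd_R : measurable_fun setT (snd : R * R -> measurableTypeR R).
Proof. exact: measurable_snd. Qed.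

(** The distribution function controls only boxes with a corner at the origin. Each side of the box
    is freed in turn, by applying [finite_measure_eq_unit] to the projection of the measure cut to a
    strip. Measurable rectangles then form a pi-system generating the product sigma-algebra. *)
Lemma copula_measure_unique mu1 mu2 :
  distribution_function_of mu1 C -> distribution_function_of mu2 C ->
  forall X, measurable X -> mu1 X = mu2 X.
Proof.
move=> C1 C2.
have finmu (mu : probability (R * R)%type R) X : measurable X -> mu X \is a fin_num.
  by move=> mX; exact: fin_num_measure.
have rect (B : set R) (v : R) : measurable B -> 0 <= v <= 1 ->
    mu1 (B `*` `[0, v]%classic) = mu2 (B `*` `[0, v]%classic).
  move=> mB v01.
  have mV : measurable ([set: R] `*` `[0, v]%classic) by apply: measurableX.
  pose n (mu : probability (R * R)%type R) :=
    pushforward (mrestr mu mV) (fst : R * R -> measurableTypeR R).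
  have nE mu A : n mu A = mu (A `*` `[0, v]%classic).
    rewrite /n /pushforward /mrestr; congr (mu _).
    by apply/seteqP; split=> -[x y] /=; [move=> [? []]|move=> []].
  have out mu : distribution_function_of mu C -> n mu (~` I) = 0%E.
    move=> muC; rewrite nE; apply: copula_measure_null => //.
      by apply: measurableX => //; apply: measurableC; exact: measurable_itv.
    by move=> [x y] /= [xI _] []/=.
  rewrite -2!nE.
  apply: (@finite_measure_eq_unit R [the measure _ _ of n mu1] [the measure _ _ of n mu2]) => //.
  - rewrite -[X in X \is a _]/(n mu1 I) nE; apply: finmu; apply: measurableX; exact: measurable_itv.
  - exact: out.
  - exact: out.
  - by move=> u u01; apply: (etrans (nE _ _)); apply/esym; rewrite [LHS]nE C1// C2.
have rect2 (A B : set R) : measurable A -> measurable B -> mu1 (A `*` B) = mu2 (A `*` B).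
  move=> mA mB.
  have mV : measurable (A `*` [set: R]) by apply: measurableX.
  pose n (mu : probability (R * R)%type R) :=
    pushforward (mrestr mu mV) (snd : R * R -> measurableTypeR R).
  have nE mu D : n mu D = mu (A `*` D).
    rewrite /n /pushforward /mrestr; congr (mu _).
    by apply/seteqP; split=> -[x y] /=; [move=> [? []]|move=> []].
  have out mu : distribution_function_of mu C -> n mu (~` I) = 0%E.
    move=> muC; rewrite nE; apply: copula_measure_null => //.
      by apply: measurableX => //; apply: measurableC; exact: measurable_itv.
    by move=> [x y] /= [_ xI] []/=.
  rewrite -2!nE.
  apply: (@finite_measure_eq_unit R [the measure _ _ of n mu1] [the measure _ _ of n mu2]) => //.
  - rewrite -[X in X \is a _]/(n mu1 I) nE; apply: finmu.
    by apply: measurableX => //; exact: measurable_itv.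
  - exact: out.
  - exact: out.
  - by move=> u u01; apply: (etrans (nE _ _)); apply/esym; rewrite [LHS]nE rect.
move=> X mX.
apply: (@measure_unique _ R _ [set A `*` B | A in measurable & B in measurable]
  (fun _ => setT) _ _ _ _ mu1 mu2) => //.
- exact: measurable_prod_measurableType.
- move=> _ _ [A mA [B mB <-]] [A' mA' [B' mB' <-]].
  exists (A `&` A'); first exact: measurableI.
  exists (B `&` B'); first exact: measurableI.
  by rewrite setXI.
- by move=> _; exists setT => //; exists setT => //; rewrite setXTT.
- by rewrite bigcup_const//; exists 0%N.
- by move=> _ [A mA [B mB <-]]; exact: rect2.
- by move=> _; rewrite -ge0_fin_numE//; exact: finmu.
Qed.

End InducedMeasure.

(** * Pointwise bounds *)

Section CopulaBounds.
Context {R : realType}.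
Variable C : copula R.
Implicit Types u v x y : R.

Lemma probability_setU (mu : probability (R * R)%type R) (X A B : set (R * R)) :
  measurable A -> measurable B -> X = A `|` B -> A `&` B = set0 ->
  (mu X = mu A + mu B)%E.
Proof. by move=> mA mB -> AB; exact: measureU. Qed.

Lemma measurable_box (a b c d : itv_bound R) :
  measurable ([set` Interval a b] `*` [set` Interval c d] : set (R * R)).
Proof. by apply: measurableX; exact: measurable_itv. Qed.

Lemma copula_incr1 u u' v : 0 <= u -> u <= u' -> u' <= 1 -> 0 <= v <= 1 ->
  copula_measure C (`]u, u']%classic `*` `[0, v]%classic) = (C u' v - C u v)%:E.
Proof.
move=> u0 uu' u'1 v01.
have u'0 := le_trans u0 uu'; have u1 := le_trans uu' u'1.
have := @probability_setU (copula_measure C) (`[0, u']%classic `*` `[0, v]%classic)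
  (`]u, u']%classic `*` `[0, v]%classic) (`[0, u]%classic `*` `[0, v]%classic)
  (measurable_box _ _ _ _) (measurable_box _ _ _ _).
rewrite !copula_measureP ?u0 ?u'0// => mE; rewrite EFinB mE ?addeK//.
- apply/seteqP; split=> -[x y] /=; rewrite !in_itv/=.
    by move=> [/andP[-> ->] ->]; have [] := ltP u x; [left|right].
  move=> [] [/andP[ux ?] ->]; first by rewrite (le_trans u0 (ltW ux)).
  by rewrite ux (le_trans _ uu').
- apply/seteqP; split=> -[x y] //=; rewrite !in_itv/=.
  by move=> [[/andP[ux _] _] [/andP[_ /(lt_le_trans ux)]]]; rewrite ltxx.
Qed.

Lemma copula_incr2 u v v' : 0 <= v -> v <= v' -> v' <= 1 -> 0 <= u <= 1 ->
  copula_measure C (`[0, u]%classic `*` `]v, v']%classic) = (C u v' - C u v)%:E.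
Proof.
move=> v0 vv' v'1 u01.
have v'0 := le_trans v0 vv'; have v1 := le_trans vv' v'1.
have := @probability_setU (copula_measure C) (`[0, u]%classic `*` `[0, v']%classic)
  (`[0, u]%classic `*` `]v, v']%classic) (`[0, u]%classic `*` `[0, v]%classic)
  (measurable_box _ _ _ _) (measurable_box _ _ _ _).
rewrite !copula_measureP ?v0 ?v'0// => mE; rewrite EFinB mE ?addeK//.
- apply/seteqP; split=> -[x y] /=; rewrite !in_itv/=.
    by move=> [-> /andP[-> ->]]; have [] := ltP v y; [left|right].
  move=> [] [-> /andP[vy ?]]; first by rewrite (le_trans v0 (ltW vy)).
  by rewrite vy (le_trans _ vv').
- apply/seteqP; split=> -[x y] //=; rewrite !in_itv/=.
  by move=> [[_ /andP[vy _]] [_ /andP[_ /(lt_le_trans vy)]]]; rewrite ltxx.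
Qed.

(** The increment is the mass of a box contained in the full strip over []u, u']], and the margin
    fixes the mass of that strip. *)
Lemma copula_lip1 u u' v : 0 <= u -> u <= u' -> u' <= 1 -> 0 <= v <= 1 ->
  0 <= C u' v - C u v <= u' - u.
Proof.
move=> u0 uu' u'1 v01; rewrite -2!lee_fin -copula_incr1// measure_ge0/=.
have u1 := le_trans uu' u'1; have u'0 := le_trans u0 uu'.
have <- : copula_measure C (`]u, u']%classic `*` `[0, 1]%classic) = (u' - u)%:E.
  by rewrite copula_incr1 ?lexx ?ler01// !copula_margin1 ?u0 ?u'0.
apply: le_measure.
- by rewrite inE; exact: measurable_box.
- by rewrite inE; exact: measurable_box.
- move=> [x y] /=; rewrite !in_itv/= => -[-> /andP[-> yv]]; split=> //.
  by move/andP: v01 => [_]; exact: le_trans yv.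
Qed.

Lemma copula_lip2 u v v' : 0 <= v -> v <= v' -> v' <= 1 -> 0 <= u <= 1 ->
  0 <= C u v' - C u v <= v' - v.
Proof.
move=> v0 vv' v'1 u01; rewrite -2!lee_fin -copula_incr2// measure_ge0/=.
have v1 := le_trans vv' v'1; have v'0 := le_trans v0 vv'.
have <- : copula_measure C (`[0, 1]%classic `*` `]v, v']%classic) = (v' - v)%:E.
  by rewrite copula_incr2 ?lexx ?ler01// !copula_margin2 ?v0 ?v'0.
apply: le_measure.
- by rewrite inE; exact: measurable_box.
- by rewrite inE; exact: measurable_box.
- move=> [x y] /=; rewrite !in_itv/= => -[/andP[-> xu] ->]; split=> //.
  by move/andP: u01 => [_]; exact: le_trans xu.
Qed.

Lemma copula_ge0 u v : 0 <= u <= 1 -> 0 <= v <= 1 -> 0 <= C u v.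
Proof. by move=> u01 v01; rewrite -lee_fin -(copula_measureP C)// measure_ge0. Qed.

Lemma copula_le_min u v : 0 <= u <= 1 -> 0 <= v <= 1 -> C u v <= Num.min u v.
Proof.
move=> u01 v01; have := @copula_lip2 u v 1; have := @copula_lip1 u 1 v.
rewrite copula_margin1// copula_margin2// le_min => h1 h2.
case/andP: (u01) => u0 u1; case/andP: (v01) => v0 v1.
by have := h1 u0 u1 (lexx _) v01; have := h2 v0 v1 (lexx _) u01; lra.
Qed.

(** For u <= v this is the Lipschitz bound in the first variable, for v < u it is monotonicity. *)
Lemma copula_ge_diag u v : 0 <= u <= 1 -> 0 <= v <= 1 ->
  C v v + Num.min u v - v <= C u v.
Proof.
move=> u01 v01; case/andP: (u01) => u0 u1; case/andP: (v01) => v0 v1.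
have [uv|vu] := leP u v.
  by have := copula_lip1 u0 uv v1 v01; lra.
by have := copula_lip1 v0 (ltW vu) u1 v01; lra.
Qed.

Lemma diag_lip x y : 0 <= x -> x <= y -> y <= 1 -> 0 <= C y y - C x x <= 2 * (y - x).
Proof.
move=> x0 xy y1.
have x01 : 0 <= x <= 1 by lra.
have y01 : 0 <= y <= 1 by lra.
by have := copula_lip1 x0 xy y1 y01; have := copula_lip2 x0 xy y1 x01; lra.
Qed.

Lemma diag_le x : 0 <= x <= 1 -> C x x <= x.
Proof. by move=> x01; have := copula_le_min x01 x01; rewrite minxx. Qed.

Lemma diag_ge0 x : 0 <= x <= 1 -> 0 <= C x x.
Proof. by move=> x01; exact: copula_ge0. Qed.

Lemma diag_ge x : 0 <= x <= 1 -> 2 * x - 1 <= C x x.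
Proof.
move=> x01; have : 0 <= C 1 1 - C x x <= 2 * (1 - x) by apply: diag_lip; lra.
by rewrite copula_margin1 ?ler01 ?lexx//; lra.
Qed.

Lemma diag_norm_le x : 0 <= x <= 1 -> `|C x x| <= 1.
Proof. by move=> x01; rewrite ger0_norm ?diag_ge0//; have := diag_le x01; lra. Qed.

End CopulaBounds.

(** * Integrals *)

Lemma bounded_measurable_integrable d (T : measurableType d) (R : realType)
    (mu : {measure set T -> \bar R}) (A : set T) (f : T -> R) (M : R) :
  measurable A -> mu A \is a fin_num -> measurable_fun A f ->
  (forall x, A x -> `|f x| <= M) -> mu.-integrable A (EFin \o f).
Proof.
move=> mA finA mf fM; apply: measurable_bounded_integrable => //.
  by rewrite -ge0_fin_numE.
by exists M; split; [exact: num_real | move=> x Mx y Ay; exact: le_trans (fM y Ay) (ltW Mx)].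
Qed.

(** * Comparison with affine functions on an interval *)

Section PiecewiseLinear.
Context {R : realType}.
Local Notation lam := (@lebesgue_measure R).
Implicit Types (a b c : R) (f : R -> R).

Lemma lebesgue_itv_fin_num a b x y :
  lam [set` Interval (BSide x a) (BSide y b)] \is a fin_num.
Proof. by rewrite lebesgue_measure_itv; case: ifP. Qed.

Lemma bounded_itv_integrable f M (i : bool) a b (j : bool) :
  measurable_fun [set` Interval (BSide i a) (BSide j b)] f ->
  (forall x, x \in Interval (BSide i a) (BSide j b) -> `|f x| <= M) ->
  lam.-integrable [set` Interval (BSide i a) (BSide j b)] (EFin \o f).
Proof.
move=> mf fM; apply: (bounded_measurable_integrable (M := M)) => //.
exact: lebesgue_itv_fin_num.
Qed.

Lemma integral_affine (al be a b : R) : a <= b ->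
  (\int[lam]_(x in `[a, b]) (al * x + be)%:E)%E = (al * (b ^+ 2 - a ^+ 2) / 2 + be * (b - a))%:E.
Proof.
rewrite le_eqVlt => /predU1P[->|ab].
  by rewrite set_itv1 integral_set1 !subrr !mulr0 mul0r addr0.
have dF (x : R) : is_derive x 1 (fun y : R => al / 2 * (y * y) + be * y) (al * x + be).
  apply: is_derive_eq; rewrite /GRing.scale/=. by field.
rewrite (@continuous_FTC2 _ _ (fun y => al / 2 * (y * y) + be * y)) //.
- by rewrite -EFinB; congr EFin; field.
- apply: continuous_subspaceT => x.
  apply: cvgD; last exact: cvg_cst.
  by apply: cvgM; [exact: cvg_cst|exact: cvg_id].
- have cF (x : R) : {for x, continuous (fun y : R => al / 2 * (y * y) + be * y)}.
    by apply: differentiable_continuous; apply/derivable1_diffP; have [] := dF x.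
  split; first by move=> x _; have [] := dF x.
  - by apply: cvg_at_right_filter; exact: cF.
  - by apply: cvg_at_left_filter; exact: cF.
- by move=> x _; rewrite derive1E; exact: derive_val.
Qed.

(** Only the open interval is constrained: x and f x are later compared for maps whose formula
    changes, possibly with a jump, at the breakpoints, and endpoints are null. *)
Lemma Rintegral_eq_affine f (al be a b : R) : a <= b ->
  (forall x, a < x < b -> f x = al * x + be) ->
  \int[lam]_(x in `[a, b]) f x = al * (b ^+ 2 - a ^+ 2) / 2 + be * (b - a).
Proof.
move=> ab fE.
have eqf : {in `]a, b[%classic, (EFin \o f) =1 (fun x => (al * x + be)%:E)}.
  by move=> x; rewrite inE/= in_itv/= => /fE ->.
have mlin : measurable_fun `]a, b[%classic (fun x : R => (al * x + be)%:E).
  apply/measurable_EFinP/measurable_funTS; apply: continuous_measurable_fun => x.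
  by apply: cvgD; [apply: cvgM; [exact: cvg_cst|exact: cvg_id]|exact: cvg_cst].
rewrite /Rintegral (integral_itv_bndoo true false); last first.
  by apply: eq_measurable_fun mlin => x /eqf.
transitivity (fine (\int[lam]_(x in `]a, b[) (al * x + be)%:E)%E).
  by congr fine; apply: eq_integral => x /eqf.
rewrite -(integral_itv_bndoo true false)//.
by rewrite integral_affine.
Qed.

Lemma Rintegral_le_affine f M (al be a b : R) : a <= b ->
  measurable_fun `[a, b]%classic f ->
  (forall x, a <= x <= b -> `|f x| <= M) ->
  (forall x, a <= x <= b -> f x <= al * x + be) ->
  \int[lam]_(x in `[a, b]) f x <= al * (b ^+ 2 - a ^+ 2) / 2 + be * (b - a).
Proof.
move=> ab mf fM fle.
rewrite -(@Rintegral_eq_affine (fun x => al * x + be))//.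
apply: le_Rintegral => //.
- by apply: (bounded_itv_integrable (M := M)) => // x; rewrite in_itv/=; exact: fM.
- apply: (bounded_itv_integrable (M := `|al| * (`|a| + `|b|) + `|be|)).
    apply/measurable_funTS; apply: continuous_measurable_fun => x.
    by apply: cvgD; [apply: cvgM; [exact: cvg_cst|exact: cvg_id]|exact: cvg_cst].
  move=> x; rewrite in_itv/= => /andP[ax xb].
  rewrite (le_trans (ler_normD _ _))// lerD2r normrM ler_wpM2l//.
  rewrite ler_norml; have := ler_norm b; have := ler_norm (- a); rewrite normrN.
  by have := normr_ge0 a; have := normr_ge0 b; lra.
Qed.

Lemma Rintegral_ge_affine f M (al be a b : R) : a <= b ->
  measurable_fun `[a, b]%classic f ->
  (forall x, a <= x <= b -> `|f x| <= M) ->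
  (forall x, a <= x <= b -> al * x + be <= f x) ->
  al * (b ^+ 2 - a ^+ 2) / 2 + be * (b - a) <= \int[lam]_(x in `[a, b]) f x.
Proof.
move=> ab mf fM fle.
rewrite -(@Rintegral_eq_affine (fun x => al * x + be))//.
apply: le_Rintegral => //.
- apply: (bounded_itv_integrable (M := `|al| * (`|a| + `|b|) + `|be|)).
    apply/measurable_funTS; apply: continuous_measurable_fun => x.
    by apply: cvgD; [apply: cvgM; [exact: cvg_cst|exact: cvg_id]|exact: cvg_cst].
  move=> x; rewrite in_itv/= => /andP[ax xb].
  rewrite (le_trans (ler_normD _ _))// lerD2r normrM ler_wpM2l//.
  rewrite ler_norml; have := ler_norm b; have := ler_norm (- a); rewrite normrN.
  by have := normr_ge0 a; have := normr_ge0 b; lra.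
- by apply: (bounded_itv_integrable (M := M)) => // x; rewrite in_itv/=; exact: fM.
Qed.

Lemma Rintegral_split f M a b c : a <= b -> b <= c ->
  measurable_fun `[a, c]%classic f -> (forall x, a <= x <= c -> `|f x| <= M) ->
  \int[lam]_(x in `[a, c]) f x = \int[lam]_(x in `[a, b]) f x + \int[lam]_(x in `[b, c]) f x.
Proof.
move=> ab bc mf fM.
have intf : lam.-integrable `[a, c]%classic (EFin \o f).
  by apply: (bounded_itv_integrable (M := M)) => // x; rewrite in_itv/=; exact: fM.
rewrite -(@Rintegral_itv_obnd_cbnd R b); last first.
  apply: integrableS intf => // x /=; rewrite !in_itv/= => /andP[bx ->].
  by rewrite (le_trans ab (ltW bx)).
by rewrite -(Rintegral_itvB intf) ?bnd_simp// addrC subrK.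
Qed.

End PiecewiseLinear.

(** * Integrals against the measure of a copula *)

Section CopulaIntegrals.
Context {R : realType}.
Local Notation I := (`[0%R, 1%R]%classic : set R).
Local Notation Q := (I `*` I).
Local Notation lam := (@lebesgue_measure R).
Variable C : copula R.
Variable mu : probability (R * R)%type R.
Hypothesis muC : distribution_function_of mu C.

(** Allows tau to be computed with an explicit measure, such as a push-forward or a mixture, in
    place of the chosen one. *)
Lemma kendall_tauE :
  kendall_tau C = 4 * (\int[mu]_(z in `[0%R, 1%R] `*` `[0%R, 1%R]) C z.1 z.2) - 1.
Proof.
rewrite /kendall_tau /Rintegral; congr (4 * fine _ - 1).
apply: eq_measure_integral => A mA _.
exact: copula_measure_unique (@copula_measureP R C) muC _ mA.
Qed.

Lemma square_integrable (f : R * R -> R) M : measurable_fun Q f ->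
  (forall z, Q z -> `|f z| <= M) -> mu.-integrable Q (EFin \o f).
Proof.
move=> mf fM; apply: (bounded_measurable_integrable (M := M)) => //.
  exact: measurable_unit_square.
by apply: fin_num_measure; exact: measurable_unit_square.
Qed.

(** On the square, C(z) is the measure of the section at z of the measurable set A of pairs (z, w)
    with 0 <= w <= z coordinatewise, and the measure of a section depends measurably on z. *)
Lemma measurable_copula : measurable_fun Q (fun z => C z.1 z.2).
Proof.
pose A : set ((R * R) * (R * R)) :=
  (fun p => p.2.1) @^-1` `[0, +oo[ `&` (fun p => p.2.2) @^-1` `[0, +oo[ `&`
  ((fun p => p.1.1 - p.2.1) @^-1` `[0, +oo[ `&` (fun p => p.1.2 - p.2.2) @^-1` `[0, +oo[).
have m11 : measurable_fun setT (fun p : (R * R) * (R * R) => p.1.1).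
  exact: (measurableT_comp measurable_fst measurable_fst).
have m12 : measurable_fun setT (fun p : (R * R) * (R * R) => p.1.2).
  exact: (measurableT_comp measurable_snd measurable_fst).
have m21 : measurable_fun setT (fun p : (R * R) * (R * R) => p.2.1).
  exact: (measurableT_comp measurable_fst measurable_snd).
have m22 : measurable_fun setT (fun p : (R * R) * (R * R) => p.2.2).
  exact: (measurableT_comp measurable_snd measurable_snd).
have pre (g : (R * R) * (R * R) -> R) : measurable_fun setT g ->
    measurable (g @^-1` `[0, +oo[).
  by move=> mg; rewrite -[X in measurable X]setTI; apply: mg => //; exact: measurable_itv.
have mA : measurable A.
  by apply: measurableI; apply: measurableI; apply: pre => //; exact: measurable_funB.
apply/measurable_EFinP.
have := measurable_funTS (D := Q) (measurable_fun_xsection mu mA).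
apply: eq_measurable_fun => z; rewrite inE => -[z1 z2] /=.
rewrite /= !in_itv/= in z1 z2; rewrite -muC//.
congr (mu _); apply/seteqP; split=> -[x y].
  rewrite /xsection/= inE /A/= !in_itv/= !andbT !subr_ge0.
  by move=> [[-> ->] [-> ->]].
rewrite /xsection/= inE /A/= !in_itv/= !andbT !subr_ge0.
by move=> [/andP[-> ->] /andP[-> ->]].
Qed.

Lemma measurable_diag : measurable_fun I (fun u => C u u).
Proof.
pose h (u : R) : R * R := (u, u).
have mh : measurable_fun I h.
  by apply: measurable_funTS; exact: (measurable_fun_pair (f := id) (g := id)).
apply: (@measurable_comp _ _ _ _ _ _ Q (fun z => C z.1 z.2) I h) => //.
- exact: measurable_unit_square.
- by move=> _ [x xI <-].
- exact: measurable_copula.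
Qed.

(** A change of variables: phi is uniformly distributed under mu, so its push-forward agrees with
    Lebesgue measure on the unit interval by [finite_measure_eq_unit]. It serves for both
    margins. *)
Lemma integral_uniform_comp (phi : R * R -> measurableTypeR R) (g : R -> R) :
  measurable_fun setT phi -> (forall z, Q z -> I (phi z)) ->
  (forall u, 0 <= u <= 1 -> mu (phi @^-1` `[0, u]%classic) = u%:E) ->
  measurable_fun I g -> (forall x, I x -> 0 <= g x) ->
  (\int[mu]_(z in Q) (g (phi z))%:E = \int[lam]_(x in I) (g x)%:E)%E.
Proof.
move=> mphi phiI phiU mg g0.
have mI : measurable (I : set (measurableTypeR R)) by exact: measurable_itv.
have mQ := @measurable_unit_square R.
have mD : measurable (phi @^-1` I).
  by rewrite -[X in measurable X]setTI; exact: mphi.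
have mgD : measurable_fun (phi @^-1` I) (fun z => (g (phi z))%:E).
  apply/measurable_EFinP.
  apply: (@measurable_comp _ _ _ _ _ _ I g _ phi) => //; last exact: measurable_funTS.
  by move=> _ [z zI <-].
(* The preimage of the unit interval contains the square but may be larger; the excess is null
   because mu is concentrated on the square. *)
transitivity (\int[mu]_(z in phi @^-1` I) (g (phi z))%:E)%E.
  rewrite (@ge0_negligible_integral _ _ _ mu (phi @^-1` I) (~` Q)) //.
  - congr integral; rewrite setDE setCK; apply/esym; rewrite setIidr//.
  - exact: measurableC.
  - by move=> z zI; rewrite lee_fin; exact: g0.
  - exact: (copula_measure_out muC).
rewrite -[LHS](@ge0_integral_pushforward _ _ _ _ _ _ mphi mu I (EFin \o g)) //; last 2 first.
- exact/measurable_EFinP.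
- by move=> x; rewrite inE/= => xI; rewrite lee_fin; exact: g0.
have outphi : pushforward mu phi (~` I) = 0%E.
  rewrite /pushforward; apply: (copula_measure_null muC).
    by rewrite -[X in measurable X]setTI; apply: mphi => //; exact: measurableC.
  by move=> z /= zI /phiI.
apply: eq_measure_integral => A mA AI.
rewrite (@finite_measure_eq_unit R [the measure _ _ of pushforward mu phi]
  [the measure _ _ of mrestr lam mI]) //.
- by rewrite /= /mrestr setIidl.
- by rewrite /= /pushforward phiU ?lexx ?ler01.
- by rewrite /= /mrestr setICl measure0.
- move=> u u01; rewrite /= /pushforward /mrestr phiU// setIC setI_unit_itv//.
  rewrite lebesgue_measure_itv/= lte_fin; case: ifPn; rewrite ?sube0// -leNgt.
  by case/andP: u01 => u0 _ u0'; rewrite (@le_anti _ _ u 0)// u0'.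
Qed.

Lemma integral_margin1 (g : R -> R) :
  measurable_fun I g -> (forall x, I x -> 0 <= g x) ->
  (\int[mu]_(z in Q) (g z.1)%:E = \int[lam]_(x in I) (g x)%:E)%E.
Proof.
apply: (@integral_uniform_comp (fst : R * R -> measurableTypeR R)).
- exact: measurable_fst_R.
- by move=> z [].
- move=> u u01; rewrite -[u in RHS](@copula_margin1 R C)// -muC ?lexx ?ler01//.
  apply: (copula_measure_restr muC).
  + by rewrite -[X in measurable X]setTI; apply: measurable_fst => //; exact: measurable_itv.
  + exact: measurable_box.
  + apply/seteqP; split=> -[x y] /=; rewrite !in_itv/=; tauto.
Qed.

Lemma integral_margin2 (g : R -> R) :
  measurable_fun I g -> (forall x, I x -> 0 <= g x) ->
  (\int[mu]_(z in Q) (g z.2)%:E = \int[lam]_(x in I) (g x)%:E)%E.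
Proof.
apply: (@integral_uniform_comp (snd : R * R -> measurableTypeR R)).
- exact: measurable_snd_R.
- by move=> z [].
- move=> u u01; rewrite -[u in RHS](@copula_margin2 R C)// -muC ?lexx ?ler01//.
  apply: (copula_measure_restr muC).
  + by rewrite -[X in measurable X]setTI; apply: measurable_snd => //; exact: measurable_itv.
  + exact: measurable_box.
  + apply/seteqP; split=> -[x y] /=; rewrite !in_itv/=; tauto.
Qed.

End CopulaIntegrals.

Section CopulaIntegrable.
Context {R : realType}.
Local Notation I := (`[0%R, 1%R]%classic : set R).
Local Notation Q := (I `*` I).
Implicit Type nu : probability (R * R)%type R.

(** The measure [nu] is independent of [C] because the tau of a mixture involves integrals of one
    copula against the measure of another. *)
Lemma copula_square_integrable (C : copula R) nu :
  nu.-integrable Q (EFin \o (fun z => C z.1 z.2)).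
Proof.
apply: (square_integrable nu (M := 1)); first exact: measurable_copula (@copula_measureP R C).
move=> z [/unit_itvP z1 /unit_itvP z2].
rewrite ger0_norm ?copula_ge0//; apply: le_trans (copula_le_min C z1 z2) _.
by rewrite ge_min; case/andP: z1 => _ ->.
Qed.

End CopulaIntegrable.

Section CopulaIntegrals.
Context {R : realType}.
Local Notation I := (`[0%R, 1%R]%classic : set R).
Local Notation Q := (I `*` I).
Local Notation lam := (@lebesgue_measure R).
Variable C : copula R.
Variable mu : probability (R * R)%type R.
Hypothesis muC : distribution_function_of mu C.

(** Layer-cake argument: 1 - max(z.1, z.2) is the length of the set of x in the unit interval above
    both coordinates. After exchanging the integrals by Tonelli, the inner one is the mass of the
    box with corner (x, x). *)
Lemma integral_diag :
  (\int[mu]_(z in Q) (1 - Num.max z.1 z.2)%:E = \int[lam]_(x in I) (C x x)%:E)%E.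
Proof.
pose A : set ((R * R) * measurableTypeR R) :=
  (Q `*` I) `&` ((fun p => p.2 - p.1.1 : R) @^-1` `[0, +oo[ `&`
                 (fun p => p.2 - p.1.2 : R) @^-1` `[0, +oo[).
have m11 : measurable_fun setT (fun p : (R * R) * measurableTypeR R => p.1.1 : R).
  exact: (measurableT_comp measurable_fst measurable_fst).
have m12 : measurable_fun setT (fun p : (R * R) * measurableTypeR R => p.1.2 : R).
  exact: (measurableT_comp measurable_snd measurable_fst).
have m2 : measurable_fun setT (fun p : (R * R) * measurableTypeR R => p.2 : R).
  exact: measurable_snd.
have pre (g : (R * R) * measurableTypeR R -> R) : measurable_fun setT g ->
    measurable (g @^-1` `[0, +oo[).
  by move=> mg; rewrite -[X in measurable X]setTI; apply: mg => //; exact: measurable_itv.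
have mQ := @measurable_unit_square R.
have mA : measurable A.
  apply: measurableI; first by apply: measurableX => //; exact: measurable_itv.
  by apply: measurableI; apply: pre; exact: measurable_funB.
have AP (z : R * R) (x : R) : A (z, x) <-> [/\ Q z, I x, z.1 <= x & z.2 <= x].
  rewrite /A /= !in_itv/= !andbT !subr_ge0; split=> [[[? ?] [? ?]]|[? ? ? ?]]; by [].
pose f (p : (R * R) * measurableTypeR R) : \bar R := (\1_A p)%:E.
have mf : measurable_fun setT f by apply/measurable_EFinP; exact: measurable_indic.
have f0 p : (0 <= f p)%E by rewrite lee_fin.
have fubini := @fubini_tonelli _ _ _ _ R mu lam f mf f0.
rewrite integral_mkcond [RHS]integral_mkcond.
rewrite (eq_integral (fun z => \int[lam]_x f (z, x)))%E; last first.
  move=> z _; rewrite patchE.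
  have FE : (\int[lam]_x f (z, x) = lam (xsection A z))%E.
    exact: (congr1 (@^~ z) (indic_fubini_tonelli_FE lam mA)).
  rewrite FE; case: ifPn => [/set_mem [z1 z2]|/negP zQ].
    have -> : xsection A z = `[Num.max z.1 z.2, 1]%classic.
      apply/seteqP; split=> x; rewrite /xsection/= inE.
        by move=> /AP[_ /unit_itvP/andP[_ x1] zx1 zx2]; rewrite in_itv/= ge_max zx1 zx2.
      rewrite in_itv/= ge_max => /andP[/andP[zx1 zx2] x1]; apply/AP; split=> //.
      by rewrite /= in_itv/= x1 andbT (le_trans _ zx1)//; case/unit_itvP/andP: z1.
    rewrite lebesgue_measure_itv/= lte_fin; case: ifPn => //; rewrite -leNgt => z1max.
    have -> : Num.max z.1 z.2 = 1; last by rewrite subrr.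
    apply/eqP; rewrite eq_le z1max andbT ge_max.
    by move: z1 z2; rewrite /= !in_itv/= => /andP[_ ->] /andP[_ ->].
  have -> : xsection A z = set0; last by rewrite measure0.
  by apply/seteqP; split=> // x; rewrite /xsection/= inE => /AP[/mem_set].
rewrite fubini; apply: eq_integral => x _; rewrite patchE.
have GE : (\int[mu]_z f (z, x) = mu (ysection A x))%E.
  exact: (congr1 (@^~ x) (indic_fubini_tonelli_GE mu mA)).
rewrite GE; case: ifPn => [/set_mem xI|/negP xI].
  have -> : ysection A x = `[0, x]%classic `*` `[0, x]%classic.
    apply/seteqP; split=> -[u v]; rewrite /ysection/= inE.
      move=> /AP[[/unit_itvP/andP[u0 _] /unit_itvP/andP[v0 _]] _ /= ux vx].
      by rewrite !in_itv/= u0 v0.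
    rewrite !in_itv/= => -[/andP[u0 ux] /andP[v0 vx]]; apply/AP; split=> //.
    move: xI; rewrite /= !in_itv/= u0 v0 => /andP[_ x1].
    by rewrite (le_trans ux)// (le_trans vx).
  by apply: muC; move: xI; rewrite /= in_itv.
have -> : ysection A x = set0; last by rewrite measure0.
by apply/seteqP; split=> // z; rewrite /ysection/= inE => /AP[_ /mem_set].
Qed.

Lemma Rintegral_id : \int[lam]_(x in I) x = 1 / 2.
Proof.
rewrite (@Rintegral_eq_affine R (fun x => x) 1 0) ?ler01//; first by field.
by move=> x _; rewrite mul1r addr0.
Qed.

Lemma measurable_min_coord : measurable_fun Q (fun z => Num.min z.1 z.2).
Proof.
by apply: measurable_funTS; apply: measurable_minr; [exact: measurable_fst|exact: measurable_snd].
Qed.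

Lemma square_integrableT (f : R * R -> R) (M : R) : measurable_fun setT f ->
  (forall z, Q z -> `|f z| <= M) -> mu.-integrable Q (EFin \o f).
Proof. by move=> mf fM; apply: (square_integrable mu (M := M)) => //; exact: measurable_funTS. Qed.

Lemma Rintegral_coord1 : \int[mu]_(z in Q) z.1 = 1 / 2.
Proof.
rewrite -Rintegral_id; congr fine; apply: (integral_margin1 muC (g := id)) => //.
by move=> x /unit_itvP/andP[].
Qed.

Lemma Rintegral_coord2 : \int[mu]_(z in Q) z.2 = 1 / 2.
Proof.
rewrite -Rintegral_id; congr fine; apply: (integral_margin2 muC (g := id)) => //.
by move=> x /unit_itvP/andP[].
Qed.

Lemma Rintegral_diag2 : \int[mu]_(z in Q) (C z.2 z.2) = \int[lam]_(x in I) C x x.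
Proof.
congr fine; apply: (integral_margin2 muC (g := fun u => C u u)).
  exact: measurable_diag muC.
by move=> x /unit_itvP; exact: diag_ge0.
Qed.

Lemma coord1_integrable : mu.-integrable Q (EFin \o (fun z => z.1)).
Proof.
apply: (square_integrableT (M := 1)); first exact: measurable_fst.
by move=> z [/unit_itvP/andP[? ?] _]; rewrite ger0_norm.
Qed.

Lemma coord2_integrable : mu.-integrable Q (EFin \o (fun z => z.2)).
Proof.
apply: (square_integrableT (M := 1)); first exact: measurable_snd.
by move=> z [_ /unit_itvP/andP[? ?]]; rewrite ger0_norm.
Qed.

Lemma min_integrable : mu.-integrable Q (EFin \o (fun z => Num.min z.1 z.2)).
Proof.
apply: (square_integrable mu (M := 1)); first exact: measurable_min_coord.
move=> z [/unit_itvP/andP[z10 z11] /unit_itvP/andP[z20 _]].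
by rewrite ger0_norm ?le_min ?ge_min ?z10 ?z11.
Qed.

(** Follows from [integral_diag], since min + max is the sum of the coordinates and each coordinate
    has mean 1/2. *)
Lemma Rintegral_min :
  \int[mu]_(z in Q) Num.min z.1 z.2 = \int[lam]_(x in I) C x x.
Proof.
have mQ := @measurable_unit_square R.
have muQ : fine (mu Q) = 1 by rewrite (copula_measure_square muC).
have i1 : mu.-integrable Q (EFin \o (fun=> 1 : R)).
  by apply: (square_integrableT (M := 1)) => // z _; rewrite normr1.
have <- : \int[mu]_(z in Q) (1 - Num.max z.1 z.2) = \int[lam]_(x in I) C x x.
  by congr fine; exact: integral_diag.
have E z : 1 - Num.max z.1 z.2 = (1 - z.1) + (Num.min z.1 z.2 - z.2) :> R.
  by rewrite maxEle minEle; case: ifP => _; ring.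
under [RHS]eq_Rintegral do rewrite E.
rewrite RintegralD//; last 2 first.
- exact: (integrableB mQ i1 coord1_integrable).
- exact: (integrableB mQ min_integrable coord2_integrable).
rewrite !RintegralB//; try exact: coord1_integrable; try exact: coord2_integrable;
  try exact: min_integrable.
rewrite Rintegral_coord1 Rintegral_coord2 Rintegral_cst// muQ; lra.
Qed.

Lemma diag2_integrable : mu.-integrable Q (EFin \o (fun z => C z.2 z.2)).
Proof.
apply: (square_integrable mu (M := 1)).
  apply: (@measurable_comp _ _ _ _ _ _ I (fun u => C u u) Q snd) => //.
  - by move=> _ [z [_ z2] <-].
  - exact: measurable_diag muC.
  - by apply: measurable_funTS; exact: measurable_snd.
by move=> z [_ /unit_itvP z2]; exact: diag_norm_le.
Qed.

Lemma Rintegral_copula_le :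
  \int[mu]_(z in Q) C z.1 z.2 <= \int[lam]_(x in I) C x x.
Proof.
rewrite -Rintegral_min; apply: le_Rintegral.
- exact: measurable_unit_square.
- exact: copula_square_integrable.
- exact: min_integrable.
- by move=> z [/unit_itvP z1 /unit_itvP z2]; exact: copula_le_min.
Qed.

(** Stated as an equation separately from the resulting inequality, because [discordant_map_copula]
    reuses it in the case of equality. *)
Lemma Rintegral_copula_lower_bound :
  \int[mu]_(z in Q) (C z.2 z.2 + Num.min z.1 z.2 - z.2) =
  2 * \int[lam]_(x in I) C x x - 1 / 2.
Proof.
have mQ := @measurable_unit_square R.
rewrite RintegralB//; last 2 first.
- exact: (integrableD mQ diag2_integrable min_integrable).
- exact: coord2_integrable.
rewrite RintegralD//; try exact: diag2_integrable; try exact: min_integrable.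
by rewrite Rintegral_diag2 Rintegral_min Rintegral_coord2; lra.
Qed.

Lemma Rintegral_copula_ge :
  2 * \int[lam]_(x in I) C x x - 1 / 2 <= \int[mu]_(z in Q) C z.1 z.2.
Proof.
have mQ := @measurable_unit_square R.
rewrite -Rintegral_copula_lower_bound; apply: le_Rintegral => //.
- exact: (integrableB mQ (integrableD mQ diag2_integrable min_integrable) coord2_integrable).
- exact: copula_square_integrable.
- by move=> z [/unit_itvP z1 /unit_itvP z2]; exact: copula_ge_diag.
Qed.

End CopulaIntegrals.

(** * Necessary conditions *)

Section Necessity.
Context {R : realType}.
Local Notation I := (`[0%R, 1%R]%classic : set R).
Local Notation lam := (@lebesgue_measure R).
Variable C : copula R.

Lemma measurable_diag_sub (a b : R) : 0 <= a -> b <= 1 ->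
  measurable_fun `[a, b]%classic (fun x => C x x).
Proof.
move=> a0 b1; apply: measurable_funS (measurable_diag (@copula_measureP R C)) => //.
by move=> x /=; rewrite !in_itv/= => /andP[ax xb]; rewrite (le_trans a0 ax) (le_trans xb b1).
Qed.

Lemma diag_norm_le_sub (a b : R) : 0 <= a -> b <= 1 ->
  forall x, a <= x <= b -> `|C x x| <= 1.
Proof. by move=> a0 b1 x xab; apply: diag_norm_le; lra. Qed.

Lemma Rintegral_diag_ge_affine (al be a b : R) : 0 <= a -> a <= b -> b <= 1 ->
  (forall x, a <= x <= b -> al * x + be <= C x x) ->
  al * (b ^+ 2 - a ^+ 2) / 2 + be * (b - a) <= \int[lam]_(x in `[a, b]) C x x.
Proof.
move=> a0 ab b1; apply: (@Rintegral_ge_affine R (fun x => C x x) 1) => //.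
- exact: measurable_diag_sub.
- exact: diag_norm_le_sub.
Qed.

Lemma Rintegral_diag_le_affine (al be a b : R) : 0 <= a -> a <= b -> b <= 1 ->
  (forall x, a <= x <= b -> C x x <= al * x + be) ->
  \int[lam]_(x in `[a, b]) C x x <= al * (b ^+ 2 - a ^+ 2) / 2 + be * (b - a).
Proof.
move=> a0 ab b1; apply: (@Rintegral_le_affine R (fun x => C x x) 1) => //.
- exact: measurable_diag_sub.
- exact: diag_norm_le_sub.
Qed.

Lemma Rintegral_diag_split (a b c : R) : 0 <= a <= b -> b <= c <= 1 ->
  \int[lam]_(x in I) C x x =
  \int[lam]_(x in `[0, a]) C x x + \int[lam]_(x in `[a, b]) C x x +
  (\int[lam]_(x in `[b, c]) C x x + \int[lam]_(x in `[c, 1]) C x x).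
Proof.
move=> ab bc.
rewrite (@Rintegral_split R (fun x => C x x) 1 0 b 1); [|lra|lra| |].
- rewrite (@Rintegral_split R (fun x => C x x) 1 0 a b); [|lra|lra| |].
  + rewrite (@Rintegral_split R (fun x => C x x) 1 b c 1); [by []|lra|lra| |].
    * by apply: measurable_diag_sub; lra.
    * by apply: diag_norm_le_sub; lra.
  + by apply: measurable_diag_sub; lra.
  + by apply: diag_norm_le_sub; lra.
- by apply: measurable_diag_sub; lra.
- by apply: diag_norm_le_sub; lra.
Qed.

(** With d = C(1/2, 1/2), the least admissible diagonal is max(0, 2x + d - 1) left of 1/2 and max(d,
    2x - 1) right of it. Its kinks 1/2 - d/2 and 1/2 + d/2 are the cut points, and its integral is
    the bound. *)
Lemma Rintegral_diag_ge :
  1 / 4 + C (1 / 2) (1 / 2) ^+ 2 / 2 <= \int[lam]_(x in I) C x x.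
Proof.
have half : 0 <= (1 / 2 : R) <= 1 by lra.
have d0 := diag_ge0 C half; have d2 := diag_le C half.
have near x : 0 <= x <= 1 / 2 -> C (1 / 2) (1 / 2) - C x x <= 2 * (1 / 2 - x).
  move=> xr; have : 0 <= C (1 / 2) (1 / 2) - C x x <= 2 * (1 / 2 - x) by apply: diag_lip; lra.
  by case/andP.
have incr x : 1 / 2 <= x <= 1 -> C (1 / 2) (1 / 2) <= C x x.
  move=> xr; have : 0 <= C x x - C (1 / 2) (1 / 2) <= 2 * (x - 1 / 2) by apply: diag_lip; lra.
  by rewrite subr_ge0 => /andP[].
move: (C (1 / 2) (1 / 2)) d0 d2 near incr => d d0 d2 near incr.
have b1 : 0 <= 1 / 2 - d / 2 by lra.
have b2 : 1 / 2 - d / 2 <= 1 / 2 by lra.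
have b3 : 1 / 2 <= 1 / 2 + d / 2 by lra.
have b4 : 1 / 2 + d / 2 <= 1 by lra.
have e1 x : 0 <= x <= 1 / 2 - d / 2 -> 0 * x + 0 <= C x x.
  by move=> xr; rewrite mul0r addr0; apply: diag_ge0; lra.
have e2 x : 1 / 2 - d / 2 <= x <= 1 / 2 -> 2 * x + (d - 1) <= C x x.
  by move=> xr; suff : d - C x x <= 2 * (1 / 2 - x); [lra|apply: near; lra].
have e3 x : 1 / 2 <= x <= 1 / 2 + d / 2 -> 0 * x + d <= C x x.
  by move=> xr; rewrite mul0r add0r; apply: incr; lra.
have e4 x : 1 / 2 + d / 2 <= x <= 1 -> 2 * x + (- 1) <= C x x.
  by move=> xr; apply: diag_ge; lra.
have /andP[half0 half1] := half.
have ab : 0 <= 1 / 2 - d / 2 <= 1 / 2 by rewrite b1.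
have bc : 1 / 2 <= 1 / 2 + d / 2 <= 1 by rewrite b3.
rewrite (Rintegral_diag_split ab bc).
apply: le_trans (lerD
  (lerD (Rintegral_diag_ge_affine (lexx 0) b1 (le_trans b2 half1) e1)
        (Rintegral_diag_ge_affine b1 b2 half1 e2))
  (lerD (Rintegral_diag_ge_affine half0 b3 b4 e3)
        (Rintegral_diag_ge_affine (le_trans half0 b3) b4 (lexx 1) e4))).
by rewrite le_eqVlt; apply/orP; left; apply/eqP; field.
Qed.

(** The greatest admissible diagonal is min(x, d) left of 1/2 and min(x, 2x + d - 1) right of it,
    with kinks at d and 1 - d. It cuts two triangles, each of area (1/2 - d)^2 / 2, off the area 1/2
    under the identity. *)
Lemma Rintegral_diag_le :
  \int[lam]_(x in I) C x x <= 1 / 2 - (1 / 2 - C (1 / 2) (1 / 2)) ^+ 2.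
Proof.
have half : 0 <= (1 / 2 : R) <= 1 by lra.
have d0 := diag_ge0 C half; have d2 := diag_le C half.
have near x : 1 / 2 <= x <= 1 -> C x x - C (1 / 2) (1 / 2) <= 2 * (x - 1 / 2).
  move=> xr; have : 0 <= C x x - C (1 / 2) (1 / 2) <= 2 * (x - 1 / 2) by apply: diag_lip; lra.
  by case/andP.
have incr x : 0 <= x <= 1 / 2 -> C x x <= C (1 / 2) (1 / 2).
  move=> xr; have : 0 <= C (1 / 2) (1 / 2) - C x x <= 2 * (1 / 2 - x) by apply: diag_lip; lra.
  by rewrite subr_ge0 => /andP[].
move: (C (1 / 2) (1 / 2)) d0 d2 near incr => d d0 d2 near incr.
have b3 : 1 / 2 <= 1 - d by lra.
have b4 : 1 - d <= 1 by lra.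
have e1 x : 0 <= x <= d -> C x x <= 1 * x + 0.
  by move=> xr; rewrite mul1r addr0; apply: diag_le; lra.
have e2 x : d <= x <= 1 / 2 -> C x x <= 0 * x + d.
  by move=> xr; rewrite mul0r add0r; apply: incr; lra.
have e3 x : 1 / 2 <= x <= 1 - d -> C x x <= 2 * x + (d - 1).
  by move=> xr; suff : C x x - d <= 2 * (x - 1 / 2); [lra|apply: near; lra].
have e4 x : 1 - d <= x <= 1 -> C x x <= 1 * x + 0.
  by move=> xr; rewrite mul1r addr0; apply: diag_le; lra.
have /andP[half0 half1] := half.
have ab : 0 <= d <= 1 / 2 by rewrite d0.
have bc : 1 / 2 <= 1 - d <= 1 by rewrite b3.
rewrite (Rintegral_diag_split ab bc).
apply: le_trans (lerD
  (lerD (Rintegral_diag_le_affine (lexx 0) d0 (le_trans d2 half1) e1)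
        (Rintegral_diag_le_affine d0 d2 half1 e2))
  (lerD (Rintegral_diag_le_affine half0 b3 b4 e3)
        (Rintegral_diag_le_affine (le_trans half0 b3) b4 (lexx 1) e4))) _.
by rewrite le_eqVlt; apply/orP; left; apply/eqP; field.
Qed.

(** Substituting C(1/2, 1/2) = (1 + beta) / 4 into six times the integral bounds produces the
    constants 3/8 = 6/16 and 3/16. *)
Lemma copula_necessary :
  [/\ -1 <= blomqvist_beta C <= 1,
      4 / 3 * spearman_footrule C - 1 / 3 <= kendall_tau C <= 2 / 3 * spearman_footrule C + 1 / 3,
      3 / 8 * (1 - blomqvist_beta C) ^+ 2 <= 1 - spearman_footrule C
    & 3 / 16 * (1 + blomqvist_beta C) ^+ 2 <= spearman_footrule C + 1 / 2].
Proof.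
have muC := @copula_measureP R C.
have := Rintegral_copula_le muC; have := Rintegral_copula_ge muC.
have := Rintegral_diag_ge; have := Rintegral_diag_le.
rewrite /kendall_tau /spearman_footrule /blomqvist_beta.
have half : 0 <= (1 / 2 : R) <= 1 by lra.
have := @diag_ge0 R C _ half; have := @diag_le R C _ half.
set d := C _ _; set D := \int[lam]_(x in _) _; set K := \int[_]_(x in _) _.
move=> d2 d0 h1 h2 h3 h4; split; [lra|lra|nra|nra].
Qed.

End Necessity.

(** * Copulas carried by the graph of a Lebesgue-preserving map *)

Section MeasurePreserving.
Context {R : realType}.
Local Notation lam := (@lebesgue_measure R).

(** Required on the whole line, so that translations and reflections qualify; the unit interval
    enters only later, through the condition that it is its own preimage. *)
Definition measure_preserving (f : R -> R) :=
  forall A : set R, measurable A -> measurable (f @^-1` A) /\ lam (f @^-1` A) = lam A.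

Lemma measure_preserving_comp f g :
  measure_preserving f -> measure_preserving g -> measure_preserving (f \o g).
Proof.
move=> fP gP A mA; have [mfA fA] := fP _ mA; have [mgA gA] := gP _ mfA.
by rewrite comp_preimage; split=> //; rewrite gA.
Qed.

Lemma measure_preserving_measurable f : measure_preserving f -> measurable_fun setT f.
Proof. by move=> fP _ A mA; rewrite setTI; have [] := fP _ mA. Qed.

Lemma measure_preserving_addr (d : R) : measure_preserving (fun x => x + d).
Proof.
have md : measurable_fun setT ((fun x => x + d) : measurableTypeR R -> measurableTypeR R).
  by apply: continuous_measurable_fun => x; apply: cvgD; [exact: cvg_id|exact: cvg_cst].
move=> A mA; split; first by rewrite -[X in measurable X]setTI; exact: md.
apply/esym; apply: (@lebesgue_measure_unique R
  [the measure _ _ of pushforward lam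
     ((fun x => x + d) : measurableTypeR R -> measurableTypeR R)]) => //.
move=> _ [[a b] _ <-] /=; rewrite /pushforward.
have -> : (fun x => x + d) @^-1` `]a, b]%classic = `]a - d, b - d]%classic :> set R.
  by apply/seteqP; split=> x /=; rewrite !in_itv/= ltrBlDr lerBrDr.
rewrite !lebesgue_measure_itv/= !lte_fin ltrD2r; case: ifP => // _.
by rewrite -!EFinB; congr EFin; ring.
Qed.

Lemma measure_preserving_reflect (s : R) : measure_preserving (fun x => s - x).
Proof.
have oppP : measure_preserving (fun x => - x).
  move=> A mA; split; last exact: lebesgue_measureN.
  by rewrite -[X in measurable X]setTI; exact: oppr_measurable.
have -> : (fun x => s - x) = (fun x => x + s) \o (fun x => - x).
  by apply/funext => x /=; rewrite addrC.
exact: measure_preserving_comp (measure_preserving_addr s) oppP.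
Qed.

Lemma lebesgue_measureU (A B : set R) : measurable A -> measurable B -> A `&` B = set0 ->
  (lam (A `|` B) = lam A + lam B)%E.
Proof. exact: (@measureU _ R (measurableTypeR R) lam). Qed.

Definition exchange (L M : set R) (g h : R -> R) (x : R) : R :=
  if x \in L then g x else if x \in M then h x else x.

(** The equivalences make L the exact preimage of M under g and M that of L under h. So the parts of
    A in M, in L and outside both have disjoint preimages, each of unchanged measure. *)
Lemma measure_preserving_exchange (L M : set R) g h :
  measurable L -> measurable M -> [disjoint L & M] ->
  measure_preserving g -> measure_preserving h ->
  (forall x, M (g x) <-> L x) -> (forall x, L (h x) <-> M x) ->
  measure_preserving (exchange L M g h).
Proof.
move=> mL mM /disj_setPS LM gP hP gLM hML A mA.
have LM0 : L `&` M = set0 by apply/seteqP; split.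
have mMA : measurable (M `&` A) by exact: measurableI.
have mLA : measurable (L `&` A) by exact: measurableI.
have [mg gE] := gP _ mMA; have [mh hE] := hP _ mLA.
have mC : measurable (A `\` (L `|` M)) by apply: measurableD => //; exact: measurableU.
have pre : exchange L M g h @^-1` A =
    g @^-1` (M `&` A) `|` (h @^-1` (L `&` A) `|` A `\` (L `|` M)).
  apply/seteqP; split=> x; rewrite /= /exchange.
    case: ifPn => [/set_mem Lx Agx|/negP xL]; first by left; split=> //; exact/gLM.
    case: ifPn => [/set_mem Mx Ahx|/negP xM Ax]; first by right; left; split=> //; exact/hML.
    by right; right; split=> // -[/mem_set|/mem_set].
  move=> [[/gLM Lx Agx]|[[/hML Mx Ahx]|[Ax nLM]]].
  - by rewrite mem_set.
  - by rewrite memNset ?mem_set// => Lx; exact: (LM x (conj Lx Mx)).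
  - rewrite memNset; last by move=> Lx; apply: nLM; left.
    by rewrite memNset// => Mx; apply: nLM; right.
rewrite pre; split; first by do !apply: measurableU.
have AE : A = (M `&` A) `|` (L `&` A `|` A `\` (L `|` M)).
  apply/seteqP; split=> x; last by case=> [[]|[[]|[]]].
  move=> Ax; have [Mx|nMx] := pselect (M x); first by left.
  have [Lx|nLx] := pselect (L x); first by right; left.
  by right; right; split=> // -[].
have dis1 : (L `&` A) `&` (A `\` (L `|` M)) = set0.
  by apply/seteqP; split=> // x [[Lx _] [_]]; apply; left.
have dis2 : (M `&` A) `&` (L `&` A `|` A `\` (L `|` M)) = set0.
  apply/seteqP; split=> // x [[Mx _] [[Lx _]|[_]]]; last by apply; right.
  exact: (LM x (conj Lx Mx)).
have dis3 : (h @^-1` (L `&` A)) `&` (A `\` (L `|` M)) = set0.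
  by apply/seteqP; split=> // x [[/hML Mx _] [_]]; apply; right.
have dis4 : (g @^-1` (M `&` A)) `&` (h @^-1` (L `&` A) `|` A `\` (L `|` M)) = set0.
  apply/seteqP; split=> // x [[/gLM Lx _] [[/hML Mx _]|[_]]]; last by apply; left.
  exact: (LM x (conj Lx Mx)).
rewrite [in RHS]AE !lebesgue_measureU//; try exact: measurableU.
by rewrite gE hE.
Qed.

End MeasurePreserving.

Section ProbabilityOfMeasure.
Context d (T : measurableType d) (R : realType).
Variable nu : {measure set T -> \bar R}.

(** An alias carrying the proof of total mass 1, so that a probability instance can be attached to
    an arbitrary such measure. *)
Definition probability_of (nu1 : nu setT = 1%E) : set T -> \bar R := nu.

Variable nu1 : nu setT = 1%E.

HB.instance Definition _ := Measure.on (probability_of nu1).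
HB.instance Definition _ := Measure_isProbability.Build _ _ _ (probability_of nu1) nu1.

Lemma probability_of_measure : exists P : probability T R, forall A, P A = nu A.
Proof. by exists [the probability _ _ of probability_of nu1]. Qed.

End ProbabilityOfMeasure.

Section MapCopula.
Context {R : realType}.
Local Notation I := (`[0%R, 1%R]%classic : set R).
Local Notation Q := (I `*` I).
Local Notation lam := (@lebesgue_measure R).

Lemma lebesgue_itv0 (u : R) : 0 <= u -> lam `[0, u]%classic = u%:E.
Proof.
rewrite lebesgue_measure_itv/= lte_fin => u0; case: ifPn; first by rewrite sube0.
by rewrite -leNgt => u0'; rewrite (@le_anti _ _ u 0)// u0'.
Qed.

Variable f : R -> R.
Hypothesis fP : measure_preserving f.
Hypothesis fI : f @^-1` I = I.

(** Lebesgue measure on the unit interval is pushed forward along x |-> (x, f x). The first margin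
    is uniform by construction, the second because f preserves measure. The explicit measure is
    returned for use with [kendall_tauE]. *)
Lemma map_copula_exists : exists C : copula R,
  (forall u v, C u v = fine (lam (`[0, u] `&` f @^-1` `[0, v]))) /\
  exists2 mu : probability (R * R)%type R, distribution_function_of mu C &
    forall A, measurable A -> mu A = lam (I `&` [set x | A (x, f x)]).
Proof.
have mI : measurable (I : set (measurableTypeR R)) by exact: measurable_itv.
pose phi (x : measurableTypeR R) : R * R := (x, f x).
have mphi : measurable_fun setT phi.
  apply: (@measurable_fun_pair _ _ _ (measurableTypeR R) R R id f) => //.
  exact: measure_preserving_measurable.
pose nu := [the measure _ _ of pushforward (mrestr lam mI) phi].
have nu1 : nu mphi setT = 1%E.
  by rewrite /= /pushforward /mrestr preimage_setT setTI lebesgue_itv0.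
have [mu muE] := probability_of_measure nu1.
have muE' A : measurable A -> mu A = lam (I `&` [set x | A (x, f x)]).
  by move=> mA; rewrite muE /= /pushforward /mrestr setIC.
pose c u v := fine (lam (`[0, u] `&` f @^-1` `[0, v])).
have muc : distribution_function_of mu c.
  move=> u v u01 v01; rewrite muE'; last exact: measurable_box.
  have -> : I `&` [set x | (`[0, u]%classic `*` `[0, v]%classic) (x, f x)] =
      `[0, u] `&` f @^-1` `[0, v].
    apply/seteqP; split=> x /=; first by case=> _ [].
    rewrite !in_itv/= => -[/andP[x0 xu] fxv]; rewrite x0 xu fxv; split=> //.
    by case/andP: u01 => _; exact: le_trans.
  rewrite /c fineK//.
  rewrite ge0_fin_numE//; apply: (@le_lt_trans _ _ (lam `[0, u]%classic)).
    apply: le_measure; rewrite ?inE//.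
    apply: measurableI => //.
    by have [] := fP (A := `[0, v]%classic) (measurable_itv _).
  by rewrite lebesgue_itv0 ?ltry//; case/andP: u01.
have c1 u : 0 <= u <= 1 -> c u 1 = u.
  move=> u01; rewrite /c fI setIC setI_unit_itv// lebesgue_itv0//.
  by case/andP: u01.
have c2 v : 0 <= v <= 1 -> c 1 v = v.
  move=> v01; rewrite /c -fI -preimage_setI setI_unit_itv//.
  have [_ ->] := fP (A := `[0, v]%classic) (measurable_itv _).
  by rewrite lebesgue_itv0//; case/andP: v01.
by exists (Copula (ex_intro _ mu muc) c1 c2); split=> //; exists mu.
Qed.

End MapCopula.

Section ExtremalMaps.
Context {R : realType}.
Local Notation I := (`[0%R, 1%R]%classic : set R).
Local Notation Q := (I `*` I).
Local Notation lam := (@lebesgue_measure R).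
Variable f : R -> R.
Hypothesis fP : measure_preserving f.
Hypothesis fI : f @^-1` I = I.

Lemma map_unit x : 0 <= x <= 1 -> 0 <= f x <= 1.
Proof.
move=> x01; apply: unit_itvP; suff : (f @^-1` I) x by [].
by rewrite fI /= in_itv.
Qed.

(** The measure lives on the graph of f, so functions agreeing there agree almost everywhere: the
    set N of disagreement misses the graph. *)
Lemma map_copula_eq_integral (mu : probability (R * R)%type R) (g1 g2 : R * R -> R) :
  (forall A, measurable A -> mu A = lam (I `&` [set x | A (x, f x)])) ->
  measurable_fun Q g1 -> measurable_fun Q g2 ->
  (forall x, 0 <= x <= 1 -> g1 (x, f x) = g2 (x, f x)) ->
  \int[mu]_(z in Q) g1 z = \int[mu]_(z in Q) g2 z.
Proof.
move=> muE mg1 mg2 g12; have mQ := @measurable_unit_square R.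
congr fine; apply: ae_eq_integral => //; try exact/measurable_EFinP.
pose N := Q `&` (g1 \- g2) @^-1` (~` [set 0]).
have mN : measurable N.
  apply: (measurable_funB mg1 mg2) => //.
  by apply: measurableC; exact: measurable_set1.
exists N; split=> //.
- apply: (etrans (muE N mN)); have -> : I `&` [set x | N (x, f x)] = set0; last by rewrite measure0.
  apply/seteqP; split=> // x [/unit_itvP x01 [_ /=]]; apply.
  by rewrite g12// subrr.
- move=> z /= /not_implyP[Qz gz]; split=> //= /eqP; rewrite subr_eq0 => /eqP g.
  by apply: gz; rewrite g.
Qed.

(** Combined with [Rintegral_min], this expresses the footrule as a one-dimensional integral
    depending directly on f. *)
Lemma map_copula_min_integral (mu : probability (R * R)%type R) :
  (forall A, measurable A -> mu A = lam (I `&` [set x | A (x, f x)])) ->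
  \int[mu]_(z in Q) Num.min z.1 z.2 = \int[lam]_(x in I) Num.min x (f x).
Proof.
move=> muE.
have mI : measurable (I : set (measurableTypeR R)) by exact: measurable_itv.
pose phi (x : measurableTypeR R) : R * R := (x, f x).
have mphi : measurable_fun setT phi.
  apply: (@measurable_fun_pair _ _ _ (measurableTypeR R) R R id f) => //.
  exact: measure_preserving_measurable.
have mQ := @measurable_unit_square R.
congr fine.
transitivity (\int[pushforward (mrestr lam mI) phi]_(z in Q) (Num.min z.1 z.2)%:E)%E.
  apply: eq_measure_integral => A mA _.
  by apply: (etrans (muE A mA)); rewrite /= /pushforward /mrestr setIC.
rewrite ge0_integral_pushforward//; last 2 first.
- apply/measurable_EFinP; exact: measurable_min_coord.
- move=> z /set_mem [/unit_itvP/andP[z1 _] /unit_itvP/andP[z2 _]].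
  by rewrite lee_fin le_min z1 z2.
have -> : phi @^-1` Q = I.
  apply/seteqP; split=> x /=; first by case.
  by move=> xI; split=> //; suff : (f @^-1` I) x by []; rewrite fI.
apply: eq_measure_integral => A mA AI.
by rewrite /= /mrestr setIidl.
Qed.

Lemma measurable_preimage_itv v : measurable (f @^-1` `[0, v]%classic).
Proof. by have [] := fP (A := `[0, v]%classic) (measurable_itv _). Qed.

Lemma lebesgue_preimage_itv v : 0 <= v -> lam (f @^-1` `[0, v]%classic) = v%:E.
Proof.
by move=> v0; have [_ ->] := fP (A := `[0, v]%classic) (measurable_itv _); rewrite lebesgue_itv0.
Qed.

(* The hypotheses say that [0, x] and the preimage of [0, f x] are nested, so
   that C(x, f x) = min(x, f x). *)
Lemma concordant_map_copula :
  (forall x y, 0 <= x <= 1 -> 0 <= y <= x -> x <= f x -> f y <= f x) ->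
  (forall x y, 0 <= x <= 1 -> 0 <= y <= 1 -> f x <= x -> f y <= f x -> y <= x) ->
  exists C : copula R,
  [/\ forall u v, C u v = fine (lam (`[0, u] `&` f @^-1` `[0, v])),
      spearman_footrule C = 6 * \int[lam]_(x in I) Num.min x (f x) - 2
    & kendall_tau C = 2 / 3 * spearman_footrule C + 1 / 3].
Proof.
move=> up dn; have [C [CE [mu muC muE]]] := map_copula_exists fP fI.
exists C; split=> //.
  by rewrite -(map_copula_min_integral muE) (Rintegral_min muC).
rewrite (kendall_tauE muC) /spearman_footrule.
rewrite (@map_copula_eq_integral mu (fun z => C z.1 z.2) (fun z => Num.min z.1 z.2)) //.
- by rewrite (Rintegral_min muC); lra.
- exact: measurable_copula muC.
- exact: measurable_min_coord.
move=> x x01 /=; have /andP[x0 x1] := x01; rewrite CE.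
have fx01 := map_unit x01; have /andP[fx0 fx1] := fx01.
have [xfx|fxx] := leP x (f x).
  rewrite setIidl ?lebesgue_itv0//.
  move=> y /=; rewrite !in_itv/= => /andP[y0 yx].
  have y01 : 0 <= y <= 1 by rewrite y0 (le_trans yx).
  by have /andP[-> _] := map_unit y01; rewrite (up x y)// y0 yx.
rewrite setIidr ?lebesgue_preimage_itv//.
move=> y /=; rewrite !in_itv/= => /andP[fy0 fyx].
have /unit_itvP y01 : I y by rewrite -fI /= in_itv/= fy0 (le_trans fyx).
by have /andP[-> _] := y01; rewrite (dn x y)// ltW.
Qed.

(* Here the hypotheses yield C(x, v) = C(v, v) - (v - x)^+ at v = f x, which is
   equality in [copula_ge_diag]. *)
Lemma discordant_map_copula :
  (forall x y, 0 <= x <= 1 -> x < y -> y <= f x -> f y <= f x) ->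
  (forall x y, 0 <= x <= 1 -> 0 <= y < x -> f x <= x -> f y <= f x -> y <= f x) ->
  exists C : copula R,
  [/\ forall u v, C u v = fine (lam (`[0, u] `&` f @^-1` `[0, v])),
      spearman_footrule C = 6 * \int[lam]_(x in I) Num.min x (f x) - 2
    & kendall_tau C = 4 / 3 * spearman_footrule C - 1 / 3].
Proof.
move=> up dn; have [C [CE [mu muC muE]]] := map_copula_exists fP fI.
exists C; split=> //.
  by rewrite -(map_copula_min_integral muE) (Rintegral_min muC).
rewrite (kendall_tauE muC) /spearman_footrule.
rewrite (@map_copula_eq_integral mu (fun z => C z.1 z.2)
  (fun z => C z.2 z.2 + Num.min z.1 z.2 - z.2)) //.
- by rewrite (Rintegral_copula_lower_bound muC); lra.
- exact: measurable_copula muC.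
- apply: measurable_funB; last exact: measurable_funTS.
  apply: measurable_funD; last exact: measurable_min_coord.
  by have /measurable_int/measurable_EFinP := diag2_integrable muC.
move=> x x01 /=; have /andP[x0 x1] := x01.
have fx01 := map_unit x01; have /andP[fx0 fx1] := fx01.
have [xfx|fxx] := leP x (f x); last first.
  rewrite addrK !CE; congr fine.
  (* When f x < x, every y < x with f y <= f x already lies below f x, so C(x, f x) and C(f x, f x)
     differ by the null point x at most. *)
  have -> : `[0, x] `&` f @^-1` `[0, f x] = (`[0, f x] `&` f @^-1` `[0, f x]) `|` [set x].
    apply/seteqP; split=> y /=; rewrite !in_itv/=.
      move=> [/andP[y0]]; rewrite le_eqVlt => /predU1P[->|yx /andP[-> fyx]]; first by right.
      by left; split=> //; rewrite y0 (dn x y) ?y0//; exact: ltW.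
    move=> [[/andP[-> yx] ->]|->]; first by split=> //; exact: le_trans yx (ltW fxx).
    by rewrite x0 fx0 !lexx.
  rewrite lebesgue_measureU//.
  - by rewrite lebesgue_measure_set1 adde0.
  - by apply: measurableI; [exact: measurable_itv|exact: measurable_preimage_itv].
  - apply/seteqP; split=> // y [[/=]]; rewrite in_itv/= => /andP[_ yfx] _ yx.
    by move: yfx; rewrite yx leNgt fxx.
(* When x <= f x, all of []x, f x]] is mapped below f x, so enlarging the first argument from x to f
   x gains its full length. *)
suff : C (f x) (f x) = C x (f x) + (f x - x) by move=> ->; ring.
apply: EFin_inj; rewrite EFinD -!muC// !muE; try exact: measurable_box.
have -> : I `&` [set y | (`[0, f x]%classic `*` `[0, f x]%classic) (y, f y)] =
   (I `&` [set y | (`[0, x]%classic `*` `[0, f x]%classic) (y, f y)]) `|` `]x, f x]%classic.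
  apply/seteqP; split=> y /=; rewrite !in_itv/=.
    move=> [y01 [/andP[y0 yfx] fy]]; have [yx|xy] := leP y x; last by right.
    by left; split=> //; rewrite y0.
  move=> [[-> [/andP[-> yx] ->]]|/andP[xy yfx]]; first by rewrite (le_trans yx).
  have y0 : 0 <= y by rewrite (le_trans x0)// ltW.
  have y01 : 0 <= y <= 1 by rewrite y0 (le_trans yfx).
  by rewrite y01 y0 yfx (up x y)//; have /andP[-> _] := map_unit y01.
rewrite lebesgue_measureU//.
- rewrite lebesgue_measure_itv/= lte_fin; case: ltP => // fxx.
  by have -> : f x - x = 0 by apply/eqP; rewrite subr_eq0 eq_le fxx.
- apply: measurableI; first exact: measurable_itv.
  have -> : [set y | (`[0, x]%classic `*` `[0, f x]%classic) (y, f y)] =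
    `[0, x]%classic `&` f @^-1` `[0, f x]%classic by [].
  by apply: measurableI; [exact: measurable_itv|exact: measurable_preimage_itv].
- apply/seteqP; split=> // y [[_ [/= + _]]]; rewrite !in_itv/= => /andP[_ yx] /andP[xy _].
  by have := le_lt_trans yx xy; rewrite ltxx.
Qed.

End ExtremalMaps.

(** * Extremal families *)

Section Families.
Context {R : realType}.
Local Notation I := (`[0%R, 1%R]%classic : set R).
Local Notation lam := (@lebesgue_measure R).

Lemma mem_set_itv (i : interval R) x : (x \in [set` i]%classic) = (x \in i).
Proof. by apply/idP/idP; rewrite inE. Qed.

Lemma exchange_oo_left (a b c d : R) g k x : a <= b -> b <= c -> x <= a ->
  exchange `]a, b[%classic `]c, d[%classic g k x = x.
Proof.
move=> ab bc xa; rewrite /exchange !mem_set_itv !in_itv/=.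
by rewrite !ltNge xa (le_trans xa (le_trans ab bc)).
Qed.

Lemma exchange_oo_first (a b c d : R) g k x : a < x < b ->
  exchange `]a, b[%classic `]c, d[%classic g k x = g x.
Proof. by move=> xab; rewrite /exchange mem_set_itv in_itv/= xab. Qed.

Lemma exchange_oo_middle (a b c d : R) g k x : b <= x <= c ->
  exchange `]a, b[%classic `]c, d[%classic g k x = x.
Proof.
move=> /andP[bx xc]; rewrite /exchange !mem_set_itv !in_itv/=.
by rewrite (ltNge x b) bx (ltNge c x) xc andbF.
Qed.

Lemma exchange_oo_second (a b c d : R) g k x : b <= c -> c < x < d ->
  exchange `]a, b[%classic `]c, d[%classic g k x = k x.
Proof.
move=> bc /andP[cx xd]; rewrite /exchange !mem_set_itv !in_itv/=.
by rewrite (ltNge x b) (le_trans bc (ltW cx)) andbF cx xd.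
Qed.

Lemma exchange_oo_right (a b c d : R) g k x : b <= c -> c <= d -> d <= x ->
  exchange `]a, b[%classic `]c, d[%classic g k x = x.
Proof.
move=> bc cd dx; rewrite /exchange !mem_set_itv !in_itv/=.
by rewrite (ltNge x b) (le_trans bc (le_trans cd dx)) (ltNge x d) dx !andbF.
Qed.

Variant exchange_co_spec (a b c d : R) (g k : R -> R) (x : R) : R -> Prop :=
| ExchangeFirst of a <= x < b : exchange_co_spec a b c d g k x (g x)
| ExchangeSecond of c <= x < d : exchange_co_spec a b c d g k x (k x)
| ExchangeLeft of x < a : exchange_co_spec a b c d g k x x
| ExchangeMiddle of b <= x < c : exchange_co_spec a b c d g k x x
| ExchangeRight of d <= x : exchange_co_spec a b c d g k x x.

Lemma exchange_coP a b c d g k x : a <= b -> b <= c -> c <= d ->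
  exchange_co_spec a b c d g k x (exchange `[a, b[%classic `[c, d[%classic g k x).
Proof.
move=> ab bc cd; rewrite /exchange !mem_set_itv !in_itv/=.
have [ax|xa] := leP a x; last first.
  by rewrite /= ifF ?leNgt ?(lt_le_trans xa (le_trans ab bc))//; apply: ExchangeLeft.
have [bx|xb] /= := leP b x; last by apply: ExchangeFirst; rewrite ax.
have [cx|xc] /= := leP c x; last by apply: ExchangeMiddle; rewrite bx.
by have [dx|xd] := leP d x; [exact: ExchangeRight|apply: ExchangeSecond; rewrite cx].
Qed.

(** Open intervals, because a reflection would turn [[a, b[] into an interval closed on the other
    side. The breakpoints stay fixed. *)
Lemma measure_preserving_exchange_reflect (a b c d s : R) : b <= c -> a + d = s -> b + c = s ->
  measure_preserving (exchange `]a, b[%classic `]c, d[%classic (fun x => s - x) (fun x => s - x)).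
Proof.
move=> bc ads bcs; apply: measure_preserving_exchange.
- exact: measurable_itv.
- exact: measurable_itv.
- apply/disj_setPS => x /= []; rewrite !in_itv/=; lra.
- exact: measure_preserving_reflect.
- exact: measure_preserving_reflect.
- by move=> x /=; rewrite !in_itv/=; split; lra.
- by move=> x /=; rewrite !in_itv/=; split; lra.
Qed.

(** Translations keep half-open intervals half-open, so here the pieces tile without leftover
    points. *)
Lemma measure_preserving_exchange_translate (a b c d e : R) : b <= c -> a + e = c -> b + e = d ->
  measure_preserving (exchange `[a, b[%classic `[c, d[%classic (fun x => x + e) (fun x => x - e)).
Proof.
move=> bc ads bcs; apply: measure_preserving_exchange.
- exact: measurable_itv.
- exact: measurable_itv.
- apply/disj_setPS => x /= []; rewrite !in_itv/=; lra.
- exact: measure_preserving_addr.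
- exact: measure_preserving_addr.
- by move=> x /=; rewrite !in_itv/=; split; lra.
- by move=> x /=; rewrite !in_itv/=; split; lra.
Qed.

Implicit Types q h : R.

(* Both maps below give the diagonal for which n u = u - C(u, u) vanishes outside
   [1/2 - 2q - h, 1/2 + 2q + h] and inside has slope +1 or -1: it climbs to q + h,
   falls to h at 1/2, climbs back to q + h and falls to 0.  The first map matches
   each ascending point with the descending point at the same level, last in
   first out. *)
Definition nested_reflection q h : R -> R :=
  exchange `]1 / 2 - 2 * q - h, 1 / 2 - 2 * q[%classic `]1 / 2 + 2 * q, 1 / 2 + 2 * q + h[%classic
    (fun x => 1 - x) (fun x => 1 - x) \o
  (exchange `]1 / 2 - 2 * q, 1 / 2 - q[%classic `]1 / 2 - q, 1 / 2[%classic
    (fun x => 1 - 2 * q - x) (fun x => 1 - 2 * q - x) \o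
  exchange `]1 / 2, 1 / 2 + q[%classic `]1 / 2 + q, 1 / 2 + 2 * q[%classic
    (fun x => 1 + 2 * q - x) (fun x => 1 + 2 * q - x)).

Lemma measure_preserving_nested_reflection q h : 0 <= q -> 0 <= h ->
  measure_preserving (nested_reflection q h).
Proof.
move=> q0 h0; do 2 ?apply: measure_preserving_comp; apply: measure_preserving_exchange_reflect; lra.
Qed.

(** The three exchanges have disjoint supports, so their composition acts piece by piece. The pieces
    are open, with the fixed breakpoints listed separately. *)
Variant nested_reflection_spec q h (x y : R) : Prop :=
| NestedId1 of x <= 1 / 2 - 2 * q - h & y = x
| NestedA1 of 1 / 2 - 2 * q - h < x < 1 / 2 - 2 * q & y = 1 - x
| NestedId2 of x = 1 / 2 - 2 * q & y = x
| NestedA2 of 1 / 2 - 2 * q < x < 1 / 2 & y = 1 - 2 * q - x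
| NestedId3 of x = 1 / 2 & y = x
| NestedA3 of 1 / 2 < x < 1 / 2 + 2 * q & y = 1 + 2 * q - x
| NestedId4 of x = 1 / 2 + 2 * q & y = x
| NestedA4 of 1 / 2 + 2 * q < x < 1 / 2 + 2 * q + h & y = 1 - x
| NestedId5 of 1 / 2 + 2 * q + h <= x & y = x.

Lemma nested_reflectionP q h x : 0 <= q -> 0 <= h ->
  nested_reflection_spec q h x (nested_reflection q h x).
Proof.
move=> q0 h0; rewrite /nested_reflection /=.
have [x1|x1] := leP x (1 / 2 - 2 * q - h).
  rewrite (@exchange_oo_left _ _ _ _ _ _ x); [|lra..].
  rewrite (@exchange_oo_left _ _ _ _ _ _ x); [|lra..].
  rewrite (@exchange_oo_left _ _ _ _ _ _ x); [|lra..].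
  by apply: NestedId1; lra.
have [x2|x2] := ltP x (1 / 2 - 2 * q).
  rewrite (@exchange_oo_left _ _ _ _ _ _ x); [|lra..].
  rewrite (@exchange_oo_left _ _ _ _ _ _ x); [|lra..].
  rewrite (@exchange_oo_first _ _ _ _ _ _ x); [|lra..].
  by apply: NestedA1; lra.
have [x3|x3] := leP x (1 / 2 - 2 * q).
  rewrite (@exchange_oo_left _ _ _ _ _ _ x); [|lra..].
  rewrite (@exchange_oo_left _ _ _ _ _ _ x); [|lra..].
  rewrite (@exchange_oo_middle _ _ _ _ _ _ x); [|lra..].
  by apply: NestedId2; lra.
have [x4|x4] := ltP x (1 / 2).
  have [x5|x5] := ltP x (1 / 2 - q).
    rewrite (@exchange_oo_left _ _ _ _ _ _ x); [|lra..].
    rewrite (@exchange_oo_first _ _ _ _ _ _ x); [|lra..].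
    rewrite (@exchange_oo_middle _ _ _ _ _ _ (1 - 2 * q - x)); [|lra..].
    by apply: NestedA2; lra.
  (* The exchange omits its centre 1/2 - q, but the reflection fixes this point as well, so it joins
     the case [NestedA2]. *)
  have [x6|x6] := leP x (1 / 2 - q).
    rewrite (@exchange_oo_left _ _ _ _ _ _ x); [|lra..].
    rewrite (@exchange_oo_middle _ _ _ _ _ _ x); [|lra..].
    rewrite (@exchange_oo_middle _ _ _ _ _ _ x); [|lra..].
    by apply: NestedA2; lra.
  rewrite (@exchange_oo_left _ _ _ _ _ _ x); [|lra..].
  rewrite (@exchange_oo_second _ _ _ _ _ _ x); [|lra..].
  rewrite (@exchange_oo_middle _ _ _ _ _ _ (1 - 2 * q - x)); [|lra..].
  by apply: NestedA2; lra.
have [x5|x5] := leP x (1 / 2).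
  rewrite (@exchange_oo_left _ _ _ _ _ _ x); [|lra..].
  rewrite (@exchange_oo_right _ _ _ _ _ _ x); [|lra..].
  rewrite (@exchange_oo_middle _ _ _ _ _ _ x); [|lra..].
  by apply: NestedId3; lra.
have [x6|x6] := ltP x (1 / 2 + 2 * q).
  have [x7|x7] := ltP x (1 / 2 + q).
    rewrite (@exchange_oo_first _ _ _ _ _ _ x); [|lra..].
    rewrite (@exchange_oo_right _ _ _ _ _ _ (1 + 2 * q - x)); [|lra..].
    rewrite (@exchange_oo_middle _ _ _ _ _ _ (1 + 2 * q - x)); [|lra..].
    by apply: NestedA3; lra.
  have [x8|x8] := leP x (1 / 2 + q).
    rewrite (@exchange_oo_middle _ _ _ _ _ _ x); [|lra..].
    rewrite (@exchange_oo_right _ _ _ _ _ _ x); [|lra..].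
    rewrite (@exchange_oo_middle _ _ _ _ _ _ x); [|lra..].
    by apply: NestedA3; lra.
  rewrite (@exchange_oo_second _ _ _ _ _ _ x); [|lra..].
  rewrite (@exchange_oo_right _ _ _ _ _ _ (1 + 2 * q - x)); [|lra..].
  rewrite (@exchange_oo_middle _ _ _ _ _ _ (1 + 2 * q - x)); [|lra..].
  by apply: NestedA3; lra.
have [x7|x7] := leP x (1 / 2 + 2 * q).
  rewrite (@exchange_oo_right _ _ _ _ _ _ x); [|lra..].
  rewrite (@exchange_oo_right _ _ _ _ _ _ x); [|lra..].
  rewrite (@exchange_oo_middle _ _ _ _ _ _ x); [|lra..].
  by apply: NestedId4; lra.
have [x8|x8] := ltP x (1 / 2 + 2 * q + h).
  rewrite (@exchange_oo_right _ _ _ _ _ _ x); [|lra..].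
  rewrite (@exchange_oo_right _ _ _ _ _ _ x); [|lra..].
  rewrite (@exchange_oo_second _ _ _ _ _ _ x); [|lra..].
  by apply: NestedA4; lra.
rewrite (@exchange_oo_right _ _ _ _ _ _ x); [|lra..].
rewrite (@exchange_oo_right _ _ _ _ _ _ x); [|lra..].
rewrite (@exchange_oo_right _ _ _ _ _ _ x); [|lra..].
by apply: NestedId5; lra.
Qed.

(* Here ascending points are matched with descending ones first in first out. *)
Definition nested_translation q h : R -> R :=
  exchange `[1 / 2 - 2 * q - h, 1 / 2 - q - h[%classic `[1 / 2 - q, 1 / 2[%classic
    (fun x => x + (q + h)) (fun x => x - (q + h)) \o
  (exchange `[1 / 2 - q - h, 1 / 2 - q[%classic `[1 / 2 + q, 1 / 2 + q + h[%classic
    (fun x => x + (2 * q + h)) (fun x => x - (2 * q + h)) \o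
  exchange `[1 / 2, 1 / 2 + q[%classic `[1 / 2 + q + h, 1 / 2 + 2 * q + h[%classic
    (fun x => x + (q + h)) (fun x => x - (q + h))).

Lemma measure_preserving_nested_translation q h : 0 <= q -> 0 <= h ->
  measure_preserving (nested_translation q h).
Proof.
move=> q0 h0.
do 2 ?apply: measure_preserving_comp; apply: measure_preserving_exchange_translate; lra.
Qed.

Variant nested_translation_spec q h (x y : R) : Prop :=
| TranslationId1 of x < 1 / 2 - 2 * q - h & y = x
| TranslationB1 of 1 / 2 - 2 * q - h <= x < 1 / 2 - q - h & y = x + (q + h)
| TranslationB2 of 1 / 2 - q - h <= x < 1 / 2 - q & y = x + (2 * q + h)
| TranslationB3 of 1 / 2 - q <= x < 1 / 2 & y = x - (q + h)
| TranslationB4 of 1 / 2 <= x < 1 / 2 + q & y = x + (q + h)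
| TranslationB5 of 1 / 2 + q <= x < 1 / 2 + q + h & y = x - (2 * q + h)
| TranslationB6 of 1 / 2 + q + h <= x < 1 / 2 + 2 * q + h & y = x - (q + h)
| TranslationId2 of 1 / 2 + 2 * q + h <= x & y = x.

(** Again the supports are disjoint, so linear arithmetic discards all combinations of branches that
    displace a point twice. *)
Lemma nested_translationP q h x : 0 <= q -> 0 <= h ->
  nested_translation_spec q h x (nested_translation q h x).
Proof.
move=> q0 h0; rewrite /nested_translation /=.
case: (@exchange_coP (1 / 2) (1 / 2 + q) (1 / 2 + q + h) (1 / 2 + 2 * q + h)
  (fun x => x + (q + h)) (fun x => x - (q + h)) x); try lra; move=> x1.
all: case: (@exchange_coP (1 / 2 - q - h) (1 / 2 - q) (1 / 2 + q) (1 / 2 + q + h)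
  (fun x => x + (2 * q + h)) (fun x => x - (2 * q + h))); try lra; move=> x2.
all: case: (@exchange_coP (1 / 2 - 2 * q - h) (1 / 2 - q - h) (1 / 2 - q) (1 / 2)
  (fun x => x + (q + h)) (fun x => x - (q + h))); try lra; move=> x3.
all: try by exfalso; lra.
(* The displacement identifies the piece up to position. The patterns with [2 * _ + _] come first
   because [_ + _] matches them too. *)
all: match goal with
  | |- nested_translation_spec _ _ ?x (?x + (2 * _ + _)) => by apply: TranslationB2; lra
  | |- nested_translation_spec _ _ ?x (?x - (2 * _ + _)) => by apply: TranslationB5; lra
  | |- nested_translation_spec _ _ ?x (?x + (_ + _)) =>
     first [by apply: TranslationB1; lra | by apply: TranslationB4; lra]
  | |- nested_translation_spec _ _ ?x (?x - (_ + _)) =>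
     first [by apply: TranslationB3; lra | by apply: TranslationB6; lra]
  | |- _ => first [by apply: TranslationId1; lra | by apply: TranslationId2; lra]
  end.
Qed.

Lemma nested_reflection_unit q h : 0 <= q -> 0 <= h -> 2 * q + h <= 1 / 2 ->
  nested_reflection q h @^-1` I = I.
Proof.
move=> q0 h0 qh; apply/seteqP; split=> x /=; rewrite !in_itv/=;
  by case: (nested_reflectionP x q0 h0) => xr ->; lra.
Qed.

Lemma nested_translation_unit q h : 0 <= q -> 0 <= h -> 2 * q + h <= 1 / 2 ->
  nested_translation q h @^-1` I = I.
Proof.
move=> q0 h0 qh; apply/seteqP; split=> x /=; rewrite !in_itv/=;
  by case: (nested_translationP x q0 h0) => xr ->; lra.
Qed.

End Families.

(** * Footrule, beta and tau of the two families *)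

Section FamilyCopulas.
Context {R : realType}.
Local Notation I := (`[0%R, 1%R]%classic : set R).
Local Notation lam := (@lebesgue_measure R).
Implicit Types q h : R.

(** The slack of two endpoints and one stray point absorbs all values of a map at its
    breakpoints. *)
Lemma lebesgue_sandwich (a b c : R) (S : set R) : a <= b -> measurable S ->
  `]a, b[%classic `<=` S -> S `<=` `[a, b]%classic `|` [set c] -> lam S = (b - a)%:E.
Proof.
move=> ab mS aS Sb.
have lamE (i j : bool) : lam [set` Interval (BSide i a) (BSide j b)] = (b - a)%:E.
  rewrite lebesgue_measure_itv/= lte_fin; case: ltP => // ba.
  by have -> : b - a = 0 by apply/eqP; rewrite subr_eq0 eq_le ba.
have mab i j : measurable ([set` Interval (BSide i a) (BSide j b)] : set (measurableTypeR R)).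
  exact: measurable_itv.
have mc : measurable ([set c] : set (measurableTypeR R)) by exact: measurable_set1.
apply/eqP; rewrite eq_le -{2}(lamE false true); apply/andP; split; last first.
  by apply: le_measure => //; rewrite inE.
rewrite -[leRHS]adde0 -(lebesgue_measure_set1 c) -(lamE true false).
apply: le_trans (measureU2 lam (mab true false) mc).
by apply: le_measure => //; rewrite inE //; exact: measurableU.
Qed.

Lemma map_copula_center (f : R -> R) (a b : R) : measure_preserving f ->
  0 <= a -> a <= b -> b <= 1 / 2 ->
  (forall x, a < x < b -> 1 / 2 < f x) ->
  (forall x, 0 <= x < 1 / 2 -> x < a \/ b < x -> 0 <= f x <= 1 / 2) ->
  fine (lam (`[0, 1 / 2] `&` f @^-1` `[0, 1 / 2])) = 1 / 2 - (b - a).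
Proof.
move=> fP a0 ab b2 fin fout.
have mJ : measurable (`[0, 1 / 2]%classic : set (measurableTypeR R)) by exact: measurable_itv.
have mf : measurable (f @^-1` `[0, 1 / 2]%classic : set (measurableTypeR R)).
  exact: measurable_preimage_itv.
have lamD : lam (`[0, 1 / 2] `\` f @^-1` `[0, 1 / 2]) = (b - a)%:E.
  (* The stray point is 1/2: nothing is assumed about its image, and the translation family may send
     it to the right half. *)
  apply: (@lebesgue_sandwich _ _ (1 / 2)) => //; first exact: (measurableD mJ mf).
    move=> x /=; rewrite !in_itv/= => xab; split; first by apply/andP; lra.
    by have := fin x xab; lra.
  move=> x /=; rewrite !in_itv/= => -[x01 /negP nfx].
  have [x2|x2] := ltP x (1 / 2); last by right; lra.
  left; apply: contraNT nfx; rewrite negb_and -!ltNge => /orP xab.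
  by apply: fout => //; lra.
have E : ((1 / 2)%:E = lam (`[0%R, (1 / 2)%R] `\` f @^-1` `[0%R, (1 / 2)%R]) +
    lam (`[0%R, (1 / 2)%R] `&` f @^-1` `[0%R, (1 / 2)%R]))%E.
  rewrite -lebesgue_itv0; first exact: (measureDI lam mJ mf).
  by rewrite divr_ge0.
rewrite lamD in E.
have -> : lam (`[0, 1 / 2] `&` f @^-1` `[0, 1 / 2]) = (1 / 2 - (b - a))%:E 
  by rewrite EFinB E [X in (X - _)%E]addeC addeK.
by [].
Qed.

Lemma map_min_integral_split (f : R -> R) (a b c d e : R) :
  measure_preserving f -> f @^-1` I = I ->
  0 <= a -> a <= b -> b <= c -> c <= d -> d <= e -> e <= 1 ->
  \int[lam]_(x in I) Num.min x (f x) =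
  \int[lam]_(x in `[0, a]) Num.min x (f x) + (\int[lam]_(x in `[a, b]) Num.min x (f x) +
  (\int[lam]_(x in `[b, c]) Num.min x (f x) + (\int[lam]_(x in `[c, d]) Num.min x (f x) +
  (\int[lam]_(x in `[d, e]) Num.min x (f x) + \int[lam]_(x in `[e, 1]) Num.min x (f x))))).
Proof.
move=> fP fI a0 ab bc cd de e1.
have mg : measurable_fun setT (fun x : R => Num.min x (f x)).
  by apply: measurable_minr => //; exact: measure_preserving_measurable.
have split (u v : R) : 0 <= u -> u <= v -> v <= 1 ->
   \int[lam]_(x in `[u, 1]) Num.min x (f x) =
   \int[lam]_(x in `[u, v]) Num.min x (f x) + \int[lam]_(x in `[v, 1]) Num.min x (f x).
  move=> u0 uv v1; apply: (@Rintegral_split R (fun x => Num.min x (f x)) 1) => //.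
    exact: measurable_funTS.
  move=> x ux; have x01 : 0 <= x <= 1 by lra.
  have := map_unit fI x01; rewrite ger0_norm ?le_min ?ge_min; first by lra.
  by have := map_unit fI x01; lra.
by rewrite (split 0 a) 1?(split a b) 1?(split b c) 1?(split c d) 1?(split d e); lra.
Qed.

End FamilyCopulas.

Section FamilyCopulas.
Context {R : realType}.
Local Notation I := (`[0%R, 1%R]%classic : set R).
Local Notation lam := (@lebesgue_measure R).
Implicit Types q h : R.

(** Phrased with the specification instead of the function, so that two case analyses leave only
    linear arithmetic. It supplies the first hypothesis of [discordant_map_copula]. *)
Lemma nested_reflection_above q h x y x' y' : 0 <= q -> 0 <= h ->
  nested_reflection_spec q h x x' -> nested_reflection_spec q h y y' ->
  x < y -> y <= x' -> y' <= x'.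
Proof.
move=> q0 h0 xS yS xy; case: xS => xr ->; move=> yx; try lra.
all: by case: yS => yr ->; lra.
Qed.

Lemma nested_reflection_below q h x y x' y' : 0 <= q -> 0 <= h ->
  nested_reflection_spec q h x x' -> nested_reflection_spec q h y y' ->
  y < x -> x' <= x -> y' <= x' -> y <= x'.
Proof.
move=> q0 h0 xS yS yx; case: xS => xr ->; move=> x'x; try lra.
all: by case: yS => yr ->; lra.
Qed.

Lemma nested_reflection_center q h x y : 0 <= q -> 0 <= h -> 2 * q + h <= 1 / 2 ->
  nested_reflection_spec q h x y ->
  (1 / 2 - 2 * q - h < x < 1 / 2 - 2 * q -> 1 / 2 < y) /\
  (0 <= x < 1 / 2 -> x < 1 / 2 - 2 * q - h \/ 1 / 2 - 2 * q < x -> 0 <= y <= 1 / 2).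
Proof. by move=> q0 h0 qh; case=> xr ->; split; try lra; move=> x01 [|]; lra. Qed.

(** Below 1/2 - q every point is fixed or sent upward, so one affine piece covers several pieces of
    the map. *)
Lemma nested_reflection_min_left q h x y : 0 <= q -> 0 <= h ->
  nested_reflection_spec q h x y ->
  (0 < x < 1 / 2 - q -> Num.min x y = 1 * x + 0) /\
  (1 / 2 - q < x < 1 / 2 -> Num.min x y = -1 * x + (1 - 2 * q)).
Proof.
by move=> q0 h0; case=> xr ->; split=> xq; try lra; rewrite minEle; case: leP; lra.
Qed.

Lemma nested_reflection_min_right q h x y : 0 <= q -> 0 <= h ->
  nested_reflection_spec q h x y ->
  [/\ 1 / 2 < x < 1 / 2 + q -> Num.min x y = 1 * x + 0,
      1 / 2 + q < x < 1 / 2 + 2 * q -> Num.min x y = -1 * x + (1 + 2 * q),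
      1 / 2 + 2 * q < x < 1 / 2 + 2 * q + h -> Num.min x y = -1 * x + 1
    & 1 / 2 + 2 * q + h < x < 1 -> Num.min x y = 1 * x + 0].
Proof.
by move=> q0 h0; case=> xr ->; split=> xq; try lra; rewrite minEle; case: leP; lra.
Qed.

Lemma nested_translation_above q h x y x' y' : 0 <= q -> 0 <= h ->
  nested_translation_spec q h x x' -> nested_translation_spec q h y y' ->
  y <= x -> x <= x' -> y' <= x'.
Proof.
move=> q0 h0 xS yS yx; case: xS => xr ->; move=> x'x; try lra.
all: by case: yS => yr ->; lra.
Qed.

Lemma nested_translation_below q h x y x' y' : 0 <= q -> 0 <= h ->
  nested_translation_spec q h x x' -> nested_translation_spec q h y y' ->
  x' <= x -> y' <= x' -> y <= x.
Proof.
move=> q0 h0 xS yS; case: xS => xr ->; move=> x'x; try lra.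
all: by case: yS => yr ->; lra.
Qed.

Lemma nested_translation_center q h x y : 0 <= q -> 0 <= h -> 2 * q + h <= 1 / 2 ->
  nested_translation_spec q h x y ->
  (1 / 2 - q - h < x < 1 / 2 - q -> 1 / 2 < y) /\
  (0 <= x < 1 / 2 -> x < 1 / 2 - q - h \/ 1 / 2 - q < x -> 0 <= y <= 1 / 2).
Proof. by move=> q0 h0 qh; case=> xr ->; split; try lra; move=> x01 [|]; lra. Qed.

Lemma nested_translation_min_left q h x y : 0 <= q -> 0 <= h ->
  nested_translation_spec q h x y ->
  (0 < x < 1 / 2 - q -> Num.min x y = 1 * x + 0) /\
  (1 / 2 - q < x < 1 / 2 -> Num.min x y = 1 * x + - (q + h)).
Proof.
by move=> q0 h0; case=> xr ->; split=> xq; try lra; rewrite minEle; case: leP; lra.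
Qed.

Lemma nested_translation_min_right q h x y : 0 <= q -> 0 <= h ->
  nested_translation_spec q h x y ->
  [/\ 1 / 2 < x < 1 / 2 + q -> Num.min x y = 1 * x + 0,
      1 / 2 + q < x < 1 / 2 + q + h -> Num.min x y = 1 * x + - (2 * q + h),
      1 / 2 + q + h < x < 1 / 2 + 2 * q + h -> Num.min x y = 1 * x + - (q + h)
    & 1 / 2 + 2 * q + h < x < 1 -> Num.min x y = 1 * x + 0].
Proof.
by move=> q0 h0; case=> xr ->; split=> xq; try lra; rewrite minEle; case: leP; lra.
Qed.

(** The value h of u - C(u, u) at 1/2 gives beta. The area under its graph, two peaks of height q +
    h around a valley of height h, is 2 (q + h)^2 - h^2, and the diagonal integrates to 1/2 minus
    that area. The bound on 2q + h keeps the map within the unit interval. *)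
Lemma reflection_copula q h : 0 <= q -> 0 <= h -> 2 * q + h <= 1 / 2 ->
  exists C : copula R,
  [/\ blomqvist_beta C = 1 - 4 * h,
      spearman_footrule C = 1 - 12 * (q + h) ^+ 2 + 6 * h ^+ 2
    & kendall_tau C = 4 / 3 * spearman_footrule C - 1 / 3].
Proof.
move=> q0 h0 qh.
have fS x : nested_reflection_spec q h x (nested_reflection q h x) by exact: nested_reflectionP.
have fP := measure_preserving_nested_reflection q0 h0.
have fI := nested_reflection_unit q0 h0 qh.
have [|| C [CE phiE tauE]] := discordant_map_copula fP fI.
- by move=> x y _; exact: (nested_reflection_above q0 h0 (fS x) (fS y)).
- by move=> x y _ /andP[_]; exact: (nested_reflection_below q0 h0 (fS x) (fS y)).
exists C; split=> //.
- rewrite /blomqvist_beta CE.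
  rewrite (@map_copula_center _ _ (1 / 2 - 2 * q - h) (1 / 2 - 2 * q) fP); first by field.
  + by lra.
  + by lra.
  + by lra.
  + by move=> x; have [] := nested_reflection_center q0 h0 qh (fS x).
  + by move=> x; have [] := nested_reflection_center q0 h0 qh (fS x).
have min_left x := nested_reflection_min_left q0 h0 (fS x).
have min_right x := nested_reflection_min_right q0 h0 (fS x).
have a1 : 0 <= 1 / 2 - q by lra.
have a2 : 1 / 2 - q <= 1 / 2 by lra.
have a3 : 1 / 2 <= 1 / 2 + q by lra.
have a4 : 1 / 2 + q <= 1 / 2 + 2 * q by lra.
have a5 : 1 / 2 + 2 * q <= 1 / 2 + 2 * q + h by lra.
have a6 : 1 / 2 + 2 * q + h <= 1 by lra.
rewrite phiE (map_min_integral_split fP fI a1 a2 a3 a4 a5 a6).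
rewrite (Rintegral_eq_affine a1 (fun x => proj1 (min_left x))).
rewrite (Rintegral_eq_affine a2 (fun x => proj2 (min_left x))).
rewrite (Rintegral_eq_affine a3 (fun x => let: And4 H _ _ _ := min_right x in H)).
rewrite (Rintegral_eq_affine a4 (fun x => let: And4 _ H _ _ := min_right x in H)).
rewrite (Rintegral_eq_affine a5 (fun x => let: And4 _ _ H _ := min_right x in H)).
rewrite (Rintegral_eq_affine a6 (fun x => let: And4 _ _ _ H := min_right x in H)).
by field.
Qed.

Lemma translation_copula q h : 0 <= q -> 0 <= h -> 2 * q + h <= 1 / 2 ->
  exists C : copula R,
  [/\ blomqvist_beta C = 1 - 4 * h,
      spearman_footrule C = 1 - 12 * (q + h) ^+ 2 + 6 * h ^+ 2
    & kendall_tau C = 2 / 3 * spearman_footrule C + 1 / 3].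
Proof.
move=> q0 h0 qh.
have fS x : nested_translation_spec q h x (nested_translation q h x) by exact: nested_translationP.
have fP := measure_preserving_nested_translation q0 h0.
have fI := nested_translation_unit q0 h0 qh.
have [|| C [CE phiE tauE]] := concordant_map_copula fP fI.
- by move=> x y _ /andP[_]; exact: (nested_translation_above q0 h0 (fS x) (fS y)).
- by move=> x y _ _; exact: (nested_translation_below q0 h0 (fS x) (fS y)).
exists C; split=> //.
- rewrite /blomqvist_beta CE.
  rewrite (@map_copula_center _ _ (1 / 2 - q - h) (1 / 2 - q) fP); first by field.
  + by lra.
  + by lra.
  + by lra.
  + by move=> x; have [] := nested_translation_center q0 h0 qh (fS x).
  + by move=> x; have [] := nested_translation_center q0 h0 qh (fS x).
have min_left x := nested_translation_min_left q0 h0 (fS x).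
have min_right x := nested_translation_min_right q0 h0 (fS x).
have a1 : 0 <= 1 / 2 - q by lra.
have a2 : 1 / 2 - q <= 1 / 2 by lra.
have a3 : 1 / 2 <= 1 / 2 + q by lra.
have a4 : 1 / 2 + q <= 1 / 2 + q + h by lra.
have a5 : 1 / 2 + q + h <= 1 / 2 + 2 * q + h by lra.
have a6 : 1 / 2 + 2 * q + h <= 1 by lra.
rewrite phiE (map_min_integral_split fP fI a1 a2 a3 a4 a5 a6).
rewrite (Rintegral_eq_affine a1 (fun x => proj1 (min_left x))).
rewrite (Rintegral_eq_affine a2 (fun x => proj2 (min_left x))).
rewrite (Rintegral_eq_affine a3 (fun x => let: And4 H _ _ _ := min_right x in H)).
rewrite (Rintegral_eq_affine a4 (fun x => let: And4 _ H _ _ := min_right x in H)).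
rewrite (Rintegral_eq_affine a5 (fun x => let: And4 _ _ H _ := min_right x in H)).
rewrite (Rintegral_eq_affine a6 (fun x => let: And4 _ _ _ H := min_right x in H)).
by field.
Qed.

End FamilyCopulas.

(** * Mixtures and the exact region *)

Section Mixture.
Context {R : realType}.
Local Notation I := (`[0%R, 1%R]%classic : set R).
Local Notation Q := (I `*` I).
Local Notation lam := (@lebesgue_measure R).
Implicit Type nu : probability (R * R)%type R.

Lemma copula_diag_integrable (C : copula R) : lam.-integrable I (EFin \o (fun x => C x x)).
Proof.
apply: (bounded_itv_integrable (M := 1)); first exact: measurable_diag (@copula_measureP R C).
by move=> x; rewrite in_itv/=; exact: diag_norm_le.
Qed.

Lemma mixture_probability nu0 nu1 (s : R) : 0 <= s <= 1 ->
  exists nu, [/\ forall A, nu A = ((1 - s)%:E * nu0 A + s%:E * nu1 A)%E &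
  forall g : R * R -> R, measurable_fun Q g -> (forall z, Q z -> 0 <= g z) ->
    (\int[nu]_(z in Q) (g z)%:E =
     (1 - s)%:E * \int[nu0]_(z in Q) (g z)%:E + s%:E * \int[nu1]_(z in Q) (g z)%:E)%E].
Proof.
move=> /andP[s0 s1]; have s1' : 0 <= 1 - s by rewrite subr_ge0.
pose m := [the measure _ _ of measure_add [the measure _ _ of mscale (NngNum s1') nu0]
  [the measure _ _ of mscale (NngNum s0) nu1]].
have mE A : m A = ((1 - s)%:E * nu0 A + s%:E * nu1 A)%E by apply: (etrans (measure_addE _ _ _)).
have m1 : m setT = 1%E by rewrite mE !probability_setT !mule1 -EFinD subrK.
have [nu nuE] := probability_of_measure m1.
exists nu; split=> [A|g mg g0]; first by rewrite nuE mE.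
have mQ := @measurable_unit_square R.
have mg' : measurable_fun Q (EFin \o g) by exact/measurable_EFinP.
have g0' z : Q z -> (0 <= (g z)%:E)%E by move=> Qz; rewrite lee_fin g0.
transitivity (\int[m]_(z in Q) (g z)%:E)%E.
  by apply: eq_measure_integral => A _ _; exact: nuE.
rewrite ge0_integral_measure_add// ge0_integral_mscale//.
by rewrite ge0_integral_mscale.
Qed.

(** Integrand and measure are both affine in s, so tau is quadratic. The constant -1 of tau splits
    along (1 - s)^2 + s^2 + 2 s (1 - s) = 1, whence the -2 in the cross term. *)
Lemma mixture_copula (C0 C1 : copula R) (s : R) : 0 <= s <= 1 ->
  exists C : copula R,
  [/\ forall u v, C u v = (1 - s) * C0 u v + s * C1 u v,
      spearman_footrule C = (1 - s) * spearman_footrule C0 + s * spearman_footrule C1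
    & kendall_tau C = (1 - s) ^+ 2 * kendall_tau C0 + s ^+ 2 * kendall_tau C1 +
        s * (1 - s) * (4 * (\int[copula_measure C0]_(z in Q) C1 z.1 z.2 +
                            \int[copula_measure C1]_(z in Q) C0 z.1 z.2) - 2)].
Proof.
move=> s01.
have [nu [nuE nuI]] := mixture_probability (copula_measure C0) (copula_measure C1) s01.
pose c u v := (1 - s) * C0 u v + s * C1 u v.
have nuc : distribution_function_of nu c.
  by move=> u v u01 v01; rewrite nuE !copula_measureP// -!EFinM -EFinD.
have c1 u : 0 <= u <= 1 -> c u 1 = u by move=> u01; rewrite /c !copula_margin1//; ring.
have c2 u : 0 <= u <= 1 -> c 1 u = u by move=> u01; rewrite /c !copula_margin2//; ring.
pose C := Copula (ex_intro _ nu nuc) c1 c2.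
have muC : distribution_function_of nu C by [].
have mQ := @measurable_unit_square R.
exists C; split=> //.
- rewrite /spearman_footrule /=.
  rewrite RintegralD//; last 2 first.
  + exact: (integrableZl _ _ (copula_diag_integrable C0)).
  + exact: (integrableZl _ _ (copula_diag_integrable C1)).
  rewrite !RintegralZl//; try exact: copula_diag_integrable.
  by ring.
- rewrite (kendall_tauE muC).
  have intC (mu : probability (R * R)%type R) : \int[mu]_(z in Q) C z.1 z.2 =
     (1 - s) * \int[mu]_(z in Q) C0 z.1 z.2 + s * \int[mu]_(z in Q) C1 z.1 z.2.
    rewrite RintegralD//; last 2 first.
    + exact: (integrableZl _ _ (copula_square_integrable C0 mu)).
    + exact: (integrableZl _ _ (copula_square_integrable C1 mu)).
    by rewrite !RintegralZl//; exact: copula_square_integrable.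
  have -> : \int[nu]_(z in Q) C z.1 z.2 =
     (1 - s) * \int[copula_measure C0]_(z in Q) C z.1 z.2 +
     s * \int[copula_measure C1]_(z in Q) C z.1 z.2.
    rewrite /Rintegral nuI; last 2 first.
    + exact: measurable_copula muC.
    + by move=> z [/unit_itvP z1 /unit_itvP z2]; exact: copula_ge0.
    have fin (mu : probability (R * R)%type R) : (\int[mu]_(z in Q) (C z.1 z.2)%:E)%E \is a fin_num.
      exact: integrable_fin_num (copula_square_integrable C mu).
    by rewrite fineD ?fineM// fin_numM.
  rewrite !intC /kendall_tau; ring.
Qed.

(* tau is quadratic along the segment from C0 to C1, on which the footrule and
   beta are affine, so the intermediate value theorem applies. *)
Lemma copula_between (C0 C1 : copula R) (p b t : R) :
  spearman_footrule C0 = p -> spearman_footrule C1 = p ->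
  blomqvist_beta C0 = b -> blomqvist_beta C1 = b ->
  kendall_tau C0 <= t <= kendall_tau C1 ->
  exists C : copula R, [/\ kendall_tau C = t, spearman_footrule C = p & blomqvist_beta C = b].
Proof.
move=> p0 p1 b0 b1 t01.
pose m := 4 * (\int[copula_measure C0]_(z in Q) C1 z.1 z.2 +
               \int[copula_measure C1]_(z in Q) C0 z.1 z.2) - 2.
pose f (s : R) := (1 - s) ^+ 2 * kendall_tau C0 + s ^+ 2 * kendall_tau C1 + s * (1 - s) * m.
have f0 : f 0 = kendall_tau C0 by rewrite /f; ring.
have f1 : f 1 = kendall_tau C1 by rewrite /f; ring.
have [||s s01 fs] := @IVT R f 0 1 t ler01.
- apply: continuous_subspaceT => x.
  have c1x : {for x, continuous (fun s : R => 1 - s)}.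
    by apply: cvgB; [exact: cvg_cst|exact: cvg_id].
  have cx : {for x, continuous (fun s : R => s)} by exact: cvg_id.
  rewrite /f; apply: cvgD; [apply: cvgD|]; apply: cvgM; try exact: cvg_cst.
  + exact: (cvgM c1x c1x).
  + exact: (cvgM cx cx).
  + exact: (cvgM cx c1x).
- by rewrite f0 f1 min_l ?max_r//; case/andP: t01; exact: le_trans.
have [C [CE phiE tauE]] := mixture_copula C0 C1 (unit_itvP s01).
exists C; split.
- by rewrite tauE -/m -/(f s).
- by rewrite phiE p0 p1; ring.
- by rewrite /blomqvist_beta CE; move: b0 b1; rewrite /blomqvist_beta; nra.
Qed.

End Mixture.

(** * [Omega] as a system of polynomial inequalities *)

Section Region.
Context {R : realType}.
Implicit Types p t b : R.

(** The bounds on beta are kept squared, with no roots: each condition then says that an affine or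
    concave polynomial is nonnegative, which suits closedness and convexity. *)
Definition region (z : R^o * R^o * R^o) : Prop :=
  [/\ -1 <= z.2 <= 1,
      4 / 3 * z.1.2 - 1 / 3 <= z.1.1 <= 2 / 3 * z.1.2 + 1 / 3,
      3 / 8 * (1 - z.2) ^+ 2 <= 1 - z.1.2
    & 3 / 16 * (1 + z.2) ^+ 2 <= z.1.2 + 1 / 2].

Lemma Omega_region : Omega R = [set z | region z].
Proof.
apply/seteqP; split=> [_ [C _ <-]|[[t p] b]] /=; first exact: copula_necessary.
rewrite /region /= => -[b1 tp h1 h2].
(* Solves the formulas of the two families for their parameters: h is read off from beta, and w
   stands for q + h in the footrule equation 12 w^2 = 1 - p + 6 h^2. *)
pose h := (1 - b) / 4; pose w := Num.sqrt ((1 - p + 6 * h ^+ 2) / 12).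
have h0 : 0 <= h by rewrite /h; lra.
have bE : b = 1 - 4 * h by rewrite /h; lra.
have wE : w ^+ 2 = (1 - p + 6 * h ^+ 2) / 12.
  by rewrite sqr_sqrtr//; have := sqr_ge0 (1 - b); have := sqr_ge0 h; lra.
have w0 : 0 <= w by exact: sqrtr_ge0.
(* After squaring, q >= 0 is exactly the upper bound on the footrule, and 2q + h <= 1/2 is exactly
   the lower one. *)
have hw : h <= w by rewrite -(@ler_pXn2r _ 2)// wE; rewrite bE in h1; lra.
have wh : 2 * w <= 1 / 2 + h.
  rewrite -(@ler_pXn2r _ 2)//; [|by rewrite nnegrE; lra|by rewrite nnegrE; lra].
  rewrite exprMn wE; rewrite bE in h2; lra.
have q0 : 0 <= w - h by lra.
have qh : 2 * (w - h) + h <= 1 / 2 by lra.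
have pE : p = 1 - 12 * (w - h + h) ^+ 2 + 6 * h ^+ 2 by rewrite subrK wE; field.
have [C0 [B0 P0 T0]] := reflection_copula q0 h0 qh.
have [C1 [B1 P1 T1]] := translation_copula q0 h0 qh.
rewrite -pE in P0 P1; rewrite -bE in B0 B1; rewrite P0 in T0; rewrite P1 in T1.
have tT : kendall_tau C0 <= t <= kendall_tau C1 by rewrite T0 T1.
have [C [<- <- <-]] := copula_between P0 P1 B0 B1 tT.
by exists C.
Qed.

(** Nonnegativity conditions match [closed_ge0], and squares are written as products so that
    continuity follows from that of products. *)
Lemma region_nonneg z : region z <->
  ((0 <= z.2 + 1 /\ 0 <= 1 - z.2) /\
   (0 <= z.1.1 - (4 / 3 * z.1.2 - 1 / 3) /\ 0 <= 2 / 3 * z.1.2 + 1 / 3 - z.1.1)) /\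
  (0 <= 1 - z.1.2 - 3 / 8 * ((1 - z.2) * (1 - z.2)) /\
   0 <= z.1.2 + 1 / 2 - 3 / 16 * ((1 + z.2) * (1 + z.2))).
Proof.
case: z => [[t p] b]; rewrite /region /= !expr2; split.
  move=> [/andP[b1 b2] /andP[t1 t2] h1 h2].
  by split; [split; split|split]; lra.
move=> [[[b1 b2] [t1 t2]] [h1 h2]].
by split; lra.
Qed.

Lemma closed_ge0 (f : R^o * R^o * R^o -> R) : continuous f -> closed [set z | 0 <= f z].
Proof.
move=> cf; have -> : [set z | 0 <= f z] = f @^-1` [set x | 0 <= x] by [].
by apply: preimage_closed; [move=> x _; exact: cf|exact: closed_ge].
Qed.

Lemma region_compact : compact [set z | region z].
Proof.
have c11 : continuous (fun z : R^o * R^o * R^o => z.1.1 : R).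
  by move=> z; apply: (cvg_comp _ _ cvg_fst cvg_fst).
have c12 : continuous (fun z : R^o * R^o * R^o => z.1.2 : R).
  by move=> z; apply: (cvg_comp _ _ cvg_fst cvg_snd).
have c2 : continuous (fun z : R^o * R^o * R^o => z.2 : R).
  by move=> z; exact: cvg_snd.
pose K := `[-1, 1]%classic `*` `[-1, 1]%classic `*` `[-1, 1]%classic : set (R^o * R^o * R^o).
apply: (@subclosed_compact _ _ K).
- have -> : [set z | region z] =
      [set z : R^o * R^o * R^o | 0 <= z.2 + 1] `&` [set z | 0 <= 1 - z.2] `&`
      ([set z | 0 <= z.1.1 - (4 / 3 * z.1.2 - 1 / 3)] `&`
       [set z | 0 <= 2 / 3 * z.1.2 + 1 / 3 - z.1.1]) `&`
      ([set z | 0 <= 1 - z.1.2 - 3 / 8 * ((1 - z.2) * (1 - z.2))] `&`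
       [set z | 0 <= z.1.2 + 1 / 2 - 3 / 16 * ((1 + z.2) * (1 + z.2))]).
    by apply/seteqP; split=> z /region_nonneg.
  have cst (x : R) : continuous (fun _ : R^o * R^o * R^o => x) by move=> z; exact: cvg_cst.
  have cM (f g : R^o * R^o * R^o -> R) : continuous f -> continuous g ->
      continuous (fun z : R^o * R^o * R^o => f z * g z : R).
    by move=> cf cg z; apply: cvgM; [exact: cf|exact: cg].
  have cD (f g : R^o * R^o * R^o -> R) : continuous f -> continuous g ->
      continuous (fun z : R^o * R^o * R^o => f z + g z : R).
    by move=> cf cg z; apply: cvgD; [exact: cf|exact: cg].
  have cB (f g : R^o * R^o * R^o -> R) : continuous f -> continuous g ->
      continuous (fun z : R^o * R^o * R^o => f z - g z : R).
    by move=> cf cg z; apply: cvgB; [exact: cf|exact: cg].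
  have quad : continuous (fun z : R^o * R^o * R^o => 3 / 8 * ((1 - z.2) * (1 - z.2)) : R).
    exact: (cM _ _ (cst _) (cM _ _ (cB _ _ (cst _) c2) (cB _ _ (cst _) c2))).
  have quad' : continuous (fun z : R^o * R^o * R^o => 3 / 16 * ((1 + z.2) * (1 + z.2)) : R).
    exact: (cM _ _ (cst _) (cM _ _ (cD _ _ (cst _) c2) (cD _ _ (cst _) c2))).
  apply: closedI; [apply: closedI; apply: closedI|apply: closedI]; apply: closed_ge0.
  + exact: (cD _ _ c2 (cst 1)).
  + exact: (cB _ _ (cst 1) c2).
  + exact: (cB _ _ c11 (cB _ _ (cM _ _ (cst (4 / 3)) c12) (cst (1 / 3)))).
  + exact: (cB _ _ (cD _ _ (cM _ _ (cst (2 / 3)) c12) (cst (1 / 3))) c11).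
  + exact: (cB _ _ (cB _ _ (cst 1) c12) quad).
  + exact: (cB _ _ (cD _ _ c12 (cst (1 / 2))) quad').
- by do !apply: compact_setX; exact: segment_compact.
- move=> [[t p] b]; rewrite /region /K /= !in_itv/= => -[b1 tp h1 h2].
  by have := sqr_ge0 (1 - b); have := sqr_ge0 (1 + b); do !split; lra.
Qed.

Lemma region_convex : convex_set (Omega R).
Proof.
rewrite Omega_region => x y l; rewrite !inE /= => -[x1 x2 x3 x4] [y1 y2 y3 y4].
have l0 : 0 <= l%:num by []. have l1 : l%:num <= 1 by [].
have -> : conv l x y =
  ((l%:num * x.1.1 + (1 - l%:num) * y.1.1, l%:num * x.1.2 + (1 - l%:num) * y.1.2),
   l%:num * x.2 + (1 - l%:num) * y.2) :> R^o * R^o * R^o by [].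
move: x y (l%:num) l0 l1 x1 x2 x3 x4 y1 y2 y3 y4 => [[t p] b] [[t' p'] b'] k k0 k1 /=.
move=> x1 x2 x3 x4 y1 y2 y3 y4; rewrite /region /=.
(* This is the convexity gap of the square, k b^2 + (1 - k) b'^2 - (k b + (1 - k) b')^2, which
   settles the two quadratic conditions. *)
have kk : 0 <= k * (1 - k) * (b - b') ^+ 2.
  by apply: mulr_ge0; [apply: mulr_ge0; lra|exact: sqr_ge0].
split; [nra|nra| |].
- have := ler_wpM2l k0 x3; have k1' : 0 <= 1 - k by lra.
  have := ler_wpM2l k1' y3; nra.
- have := ler_wpM2l k0 x4; have k1' : 0 <= 1 - k by lra.
  have := ler_wpM2l k1' y4; nra.
Qed.

Lemma region_section p t b : - (1 / 2) <= p <= 1 ->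
  region (t, p, b) <->
  (4 / 3 * p - 1 / 3 <= t <= 2 / 3 * p + 1 / 3) /\ (b_minus p <= b <= b_plus p).
Proof.
move=> p01; rewrite /region /b_minus /b_plus /= le_min.
set S := Num.sqrt _; set T := 4 / Num.sqrt 3 * _.
have S0 : 0 <= S by exact: sqrtr_ge0.
have SE : S ^+ 2 = 8 / 3 * (1 - p) by rewrite sqr_sqrtr//; lra.
have T0 : 0 <= T by apply: mulr_ge0; [apply: divr_ge0; rewrite ?sqrtr_ge0|exact: sqrtr_ge0].
have TE : T ^+ 2 = 16 / 3 * (p + 1 / 2).
  rewrite /T !exprMn exprVn !sqr_sqrtr; [by field|lra|lra].
split=> [[b1 tp h1 h2]|[tp /andP[hb /andP[b1 hT]]]].
- split=> //; apply/andP; split; [nra|apply/andP; split; [lra|nra]].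
(* From p >= -1/2; thus b >= 1 - S >= -1, which makes squaring 1 + b <= T legitimate. The condition
   b <= 1 comes from the minimum in [b_plus]. *)
- have S2 : S <= 2 by nra.
  by split=> //; [lra|nra|nra].
Qed.

End Region.

Theorem corollary4p1 (R : realType) :
  [/\ compact (Omega R),
      convex_set (Omega R)
    & forall p : R, - (1 / 2) <= p <= 1 ->
        [set tb : R * R | Omega R (tb.1, p, tb.2)] =
        `[4 / 3 * p - 1 / 3, 2 / 3 * p + 1 / 3] `*` `[b_minus p, b_plus p]].
Proof.
split.
- by rewrite Omega_region; exact: region_compact.
- exact: region_convex.
- move=> p p01; rewrite Omega_region; apply/seteqP; split=> -[t b] /=.
    by move=> /(region_section _ _ p01) [tp bp]; rewrite !in_itv.
  by rewrite !in_itv/= => -[tp bp]; apply/(region_section _ _ p01).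
Qed.
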